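(* Let $M$ be a simply connected open subset of $\mathbb{R}^2$ with coordinates $(u,v)$, and let $\hat F:M\to\mathcal{G}$ be a regular admissible frame, with $$\hat F^{-1}\,d\hat F=\alpha_0+\lambda B_1\,du+\lambda^{-1}B_{-1}\,dv .$$ Let $\mu$ be any real number not equal to $1$ or $0$. Then the map $f:M\to\mathbb{S}^3=SU(2)$ defined by $$f=\hat F\big|_{\lambda=\mu}\,\hat F^{-1}\big|_{\lambda=1}$$ is an immersion of constant (intrinsic) Gauss curvature $$K_\mu=1-\rho^2,\qquad \rho:=\frac{\mu+1}{\mu-1}.$$ The first and second fundamental forms of $f$ are given by $$\mathrm{I}=A^2\,du^2+2AB\cos\phi\,du\,dv+B^2\,dv^2,\qquad \mathrm{II}=2\rho AB\sin\phi\,du\,dv,$$ where $A=(\mu-1)|B_1|$, $B=(\mu^{-1}-1)|B_{-1}|$, and $\phi$ is the angle between $B_1$ and $B_{-1}$.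
   Context: The unit sphere $\mathbb{S}^3\subset\mathbb{R}^4=\mathbb{C}^2$ is identified with $SU(2)$ via $(z,w)\mapsto \begin{pmatrix} z & w\\ -\bar w & \bar z\end{pmatrix}$. Its standard metric (constant curvature $1$) is $g(V,W)=\langle x^{-1}V,x^{-1}W\rangle$ for $V,W\in T_xSU(2)$, where $\langle X,Y\rangle=-\frac12\mathrm{Tr}(XY)$ on $\mathfrak{su}(2)$, and $|X|=\langle X,X\rangle^{1/2}$. An orthonormal basis of $\mathfrak{su}(2)$ is $$e_1=\begin{pmatrix}0&1\\-1&0\end{pmatrix},\quad e_2=\begin{pmatrix}0&i\\ i&0\end{pmatrix},\quad e_3=\begin{pmatrix}i&0\\0&-i\end{pmatrix}.$$ Set $\mathfrak{k}=\mathrm{span}(e_3)$ and $\mathfrak{p}=\mathrm{span}(e_1,e_2)$ (real spans), so $\mathfrak{su}(2)=\mathfrak{k}+\mathfrak{p}$. $\mathcal{G}=\Lambda SL(2,\mathbb{C})_{\sigma\tau}$ is the twisted loop group: the group of loops $x=x(\lambda)$ in $SL(2,\mathbb{C})$ fixed by the two involutions $$\sigma x(\lambda)=\mathrm{Ad}_{\mathrm{diag}(1,-1)}\big(x(-\lambda)\big),\qquad \tau x(\lambda)=\Big(\overline{x(\bar\lambda)}^{\,t}\Big)^{-1}.$$ The loops considered are understood to be defined and holomorphic for all $\lambda\in\mathbb{C}^*=\mathbb{C}\setminus\{0\}$, so they may be evaluated at real $\lambda\ne0$, where they take values in $SU(2)$. An admissible frame is a smooth map $\hat F:M\to\mathcal{G}$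 (smooth in $(u,v)$ and $\lambda$ jointly) whose Maurer–Cartan form has the form $\hat F^{-1}d\hat F=\alpha_0+\lambda B_1\,du+\lambda^{-1}B_{-1}\,dv$, where $\alpha_0\in\mathfrak{k}\otimes\Omega^1(M)$ and $B_{\pm1}:M\to\mathfrak{p}$ do not depend on $\lambda$. It is regular at a point $p\in M$ if $B_1(p)$ and $B_{-1}(p)$ are linearly independent, and regular if it is regular at every point of $M$. Conventions: the second fundamental form is taken with respect to the unit normal $n=f\,\mathrm{Ad}_F e_3$ with $F=\hat F|_{\lambda=1}$, that is, $\mathrm{II}=\langle f^{-1}f_{uu},f^{-1}n\rangle\,du^2+2\langle f^{-1}f_{uv},f^{-1}n\rangle\,du\,dv+\langle f^{-1}f_{vv},f^{-1}n\rangle\,dv^2$, where second derivatives of $f$ are taken in $\mathbb{R}^4$ (the space of matrices spanned by $I_2,e_1,e_2,e_3$, with $\langle\cdot,\cdot\rangle$ denoting its Euclidean inner product). The angle $\phi$ is measured from $B_1$ to $B_{-1}$ in the plane $\mathfrak{p}$ oriented by $(e_1,e_2)$. *)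

(* Defs.v *)
From HB Require Import structures.
From mathcomp Require Import all_boot all_order all_algebra.
From mathcomp Require Import complex.
From mathcomp Require Import all_classical all_reals all_analysis.

Set Implicit Arguments.
Unset Strict Implicit.
Unset Printing Implicit Defensive.

Import Order.TTheory GRing.Theory Num.Theory.
Import numFieldNormedType.Exports.

Local Open Scope classical_set_scope.
Local Open Scope ring_scope.

Section Smoothness.
Context {R : realType}.

(* C^k on an open set of a finite-dimensional space: all iterated directional
   derivatives of order at most k exist and are continuous *)
Fixpoint is_Ck {V : normedModType R} (k : nat) (D : set V) (f : V -> R) : Prop :=
  (forall x, D x -> {for x, continuous f}) /\
  (if k is k'.+1 then
     forall v, (forall x, D x -> derivable f x v) /\ is_Ck k' D ('D_v f)
   else True).

Definition smooth {V : normedModType R} (D : set V) (f : V -> R) : Prop :=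
  forall k, is_Ck k D f.

(* complex matrices are differentiated entrywise, as real functions *)
Definition smooth_mx {V : normedModType R} (D : set V) (F : V -> 'M[R[i]]_2) :=
  forall i j, smooth D (fun x => complex.Re (F x i j)) /\
              smooth D (fun x => complex.Im (F x i j)).

Definition deriv_mx {V : normedModType R} (v : V) (F : V -> 'M[R[i]]_2) (x : V)
    : 'M[R[i]]_2 :=
  \matrix_(i, j) ('D_v (fun y => complex.Re (F y i j)) x +i*
                  'D_v (fun y => complex.Im (F y i j)) x)%C.

Definition simply_connected (M : set (R * R)) : Prop :=
  (forall x y, M x -> M y ->
     exists gamma : R -> R * R,
       [/\ {within `[0, 1], continuous gamma}, gamma 0 = x, gamma 1 = y &
           forall t, 0 <= t <= 1 -> M (gamma t)]) /\
  (forall gamma : R -> R * R, {within `[0, 1], continuous gamma} ->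
     (forall t, 0 <= t <= 1 -> M (gamma t)) -> gamma 0 = gamma 1 ->
     exists H : R * R -> R * R,
       [/\ {within `[0, 1] `*` `[0, 1], continuous H},
           forall s t, 0 <= s <= 1 -> 0 <= t <= 1 -> M (H (s, t)),
           forall t, 0 <= t <= 1 -> H (0, t) = gamma t /\ H (1, t) = gamma 0 &
           forall s, 0 <= s <= 1 -> H (s, 0) = gamma 0 /\ H (s, 1) = gamma 0]).

(* coordinate directions: du for index 0, dv for index 1 *)
Definition dir (i : 'I_2) : R * R := if i == 0 then (1, 0) else (0, 1).

Definition pu (F : R * R -> 'M[R[i]]_2) := deriv_mx (dir 0) F.
Definition pv (F : R * R -> 'M[R[i]]_2) := deriv_mx (dir 1) F.

End Smoothness.

Section SU2.
Context {R : realType}.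
Implicit Types X Y V W x : 'M[R[i]]_2.

Definition mx2 (a b c d : R[i]) : 'M[R[i]]_2 :=
  \matrix_(i, j) if i == 0 then (if j == 0 then a else b)
                 else (if j == 0 then c else d).

Definition e1 : 'M[R[i]]_2 := mx2 0 1 (-1) 0.
Definition e2 : 'M[R[i]]_2 := mx2 0 (0 +i* 1)%C (0 +i* 1)%C 0.
Definition e3 : 'M[R[i]]_2 := mx2 (0 +i* 1)%C 0 0 (0 -i* 1)%C.

(* multiplication by a real scalar *)
Definition rsc (a : R) X : 'M[R[i]]_2 := (a%:C)%C *: X.

Definition in_k X : Prop := exists a, X = rsc a e3.
Definition in_p X : Prop := exists a b, X = rsc a e1 + rsc b e2.

Definition lin_indep X Y : Prop :=
  forall a b : R, rsc a X + rsc b Y = 0 -> a = 0 /\ b = 0.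

Definition adjoint X : 'M[R[i]]_2 := map_mx (@conjc R) X^T.

Definition SU2 x : Prop := \det x = 1 /\ adjoint x *m x = 1%:M.
Definition su2 X : Prop := \tr X = 0 /\ adjoint X = - X.

(* the trace is real on su(2) *)
Definition su2_ip X Y : R := complex.Re (- 2^-1 * \tr (X *m Y)).
Definition su2_norm X : R := Num.sqrt (su2_ip X X).

Definition sphere_metric x V W : R := su2_ip (invmx x *m V) (invmx x *m W).

(* Euclidean inner product of R^4 = span(1, e1, e2, e3) = C^2, an element being
   determined by its first row (z, w) *)
Definition R4_ip X Y : R :=
  complex.Re (X 0 0) * complex.Re (Y 0 0) +
  complex.Im (X 0 0) * complex.Im (Y 0 0) +
  complex.Re (X 0 1) * complex.Re (Y 0 1) +
  complex.Im (X 0 1) * complex.Im (Y 0 1).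

(* phi is a determination of the angle from X to Y in the plane p oriented by
   (e1, e2) *)
Definition oriented_angle X Y (phi : R) : Prop :=
  exists theta : R,
    X = rsc (su2_norm X) (rsc (cos theta) e1 + rsc (sin theta) e2) /\
    Y = rsc (su2_norm Y)
          (rsc (cos (theta + phi)) e1 + rsc (sin (theta + phi)) e2).

End SU2.

Section Frames.
Context {R : realType}.
Implicit Types (M : set (R * R)) (x : R[i] -> 'M[R[i]]_2).
Implicit Types (Fh : R * R -> R[i] -> 'M[R[i]]_2).

Definition sigma x (z : R[i]) : 'M[R[i]]_2 :=
  mx2 1 0 0 (-1) *m x (- z) *m invmx (mx2 1 0 0 (-1)).

Definition tau x (z : R[i]) : 'M[R[i]]_2 := invmx (adjoint (x (conjc z))).

(* loops are functions on C^*; their value at 0 is irrelevant *)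
Definition twisted_loop x : Prop :=
  [/\ forall z, z != 0 -> \det (x z) = 1,
      forall z, z != 0 -> forall i j,
        derivable (fun w : (R[i])^o => x w i j : (R[i])^o) z 1,
      forall z, z != 0 -> sigma x z = x z &
      forall z, z != 0 -> tau x z = x z].

Definition maurer_cartan (F : R * R -> 'M[R[i]]_2) (i : 'I_2) (p : R * R) :=
  invmx (F p) *m deriv_mx (dir i) F p.

(* alpha_0 = au du + av dv *)
Record admissible_frame M Fh (au av B1 Bm1 : R * R -> 'M[R[i]]_2) : Prop := {
  frame_loop : forall p, M p -> twisted_loop (Fh p);
  frame_smooth :
    smooth_mx [set q : (R * R) * (R * R) | M q.1 /\ q.2 != 0]
      (fun q => Fh q.1 (q.2.1 +i* q.2.2)%C);
  frame_alpha_k : forall p, M p -> in_k (au p) /\ in_k (av p);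
  frame_alpha_smooth : smooth_mx M au /\ smooth_mx M av;
  frame_B_p : forall p, M p -> in_p (B1 p) /\ in_p (Bm1 p);
  frame_mc : forall p z, M p -> z != 0 ->
    maurer_cartan (Fh ^~ z) 0 p = au p + z *: B1 p /\
    maurer_cartan (Fh ^~ z) 1 p = av p + z^-1 *: Bm1 p
}.

Definition regular_frame M (B1 Bm1 : R * R -> 'M[R[i]]_2) : Prop :=
  forall p, M p -> lin_indep (B1 p) (Bm1 p).

End Frames.

Section Surfaces.
Context {R : realType}.
Implicit Types (M : set (R * R)) (f n : R * R -> 'M[R[i]]_2).
Implicit Types (g : R * R -> 'M[R]_2).

Definition immersion M f : Prop :=
  [/\ forall p, M p -> SU2 (f p), smooth_mx M f &
      forall p, M p -> lin_indep (pu f p) (pv f p)].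

Definition unit_normal M f n : Prop :=
  forall p, M p ->
    [/\ su2 (invmx (f p) *m n p), sphere_metric (f p) (n p) (n p) = 1,
        sphere_metric (f p) (pu f p) (n p) = 0 &
        sphere_metric (f p) (pv f p) (n p) = 0].

(* fundamental forms, evaluated on xi = (du, dv) *)
Definition first_form f (p xi : R * R) : R :=
  sphere_metric (f p) (pu f p) (pu f p) * xi.1 ^+ 2 +
  2 * sphere_metric (f p) (pu f p) (pv f p) * (xi.1 * xi.2) +
  sphere_metric (f p) (pv f p) (pv f p) * xi.2 ^+ 2.

Definition second_form f n (p xi : R * R) : R :=
  R4_ip (invmx (f p) *m pu (pu f) p) (invmx (f p) *m n p) * xi.1 ^+ 2 +
  2 * R4_ip (invmx (f p) *m pv (pu f) p) (invmx (f p) *m n p) * (xi.1 * xi.2) +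
  R4_ip (invmx (f p) *m pv (pv f) p) (invmx (f p) *m n p) * xi.2 ^+ 2.

Definition induced_metric f (p : R * R) : 'M[R]_2 :=
  \matrix_(i, j)
    sphere_metric (f p) (deriv_mx (dir i) f p) (deriv_mx (dir j) f p).

Definition dg g (i j k : 'I_2) (p : R * R) : R :=
  'D_(dir i) (fun q => g q j k) p.

Definition christoffel g (k i j : 'I_2) (p : R * R) : R :=
  2^-1 * \sum_l invmx (g p) k l * (dg g i j l p + dg g j i l p - dg g l i j p).

(* the component along the l-th coordinate field of R(d_i, d_j) d_k, where
   R(X, Y) = [nabla_X, nabla_Y] - nabla_[X, Y] *)
Definition riemann g (l i j k : 'I_2) (p : R * R) : R :=
  'D_(dir i) (christoffel g l j k) p - 'D_(dir j) (christoffel g l i k) p +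
  \sum_m (christoffel g l i m p * christoffel g m j k p -
          christoffel g l j m p * christoffel g m i k p).

Definition gauss_curvature g (p : R * R) : R :=
  (\sum_l g p 0 l * riemann g l 0 1 1 p) / \det (g p).

End Surfaces.

(* Main.v *)
Require Import Defs.
From mathcomp Require Import all_boot all_order all_algebra.
From mathcomp Require Import complex ring lra.
From mathcomp Require Import all_classical all_reals all_analysis.
Import Order.TTheory GRing.Theory Num.Theory.
Import numFieldNormedType.Exports.
Local Open Scope classical_set_scope.
Local Open Scope ring_scope.

(** Write [G] and [F] for the frame at [mu] and at [1], so that [f = G F^-1],
    and [P], [Q] for their Maurer-Cartan forms.  For every matrix function [W],
    [d(G W F^-1) = G (P W + dW - W Q) F^-1].  For [W = 1] the [alpha_0] parts of
    [P] and [Q] cancel, and [f_u = G X F^-1], [f_v = G Y F^-1] with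
    [X = (mu - 1) B1] and [Y = (mu^-1 - 1) B_-1].  Hence [f^-1 df] is
    [Ad_F (X du + Y dv)], and [Ad_F] is an isometry: the first fundamental form
    is the Gram matrix of [X] and [Y] in the plane [p], and [e3], which is
    orthogonal to [p], gives the unit normal.  The same formula with [W = X] and
    [W = Y] gives the second derivatives of [f]; their [e3] parts are zero except
    for that of [mu^-1 B_-1 X - X B_-1] in [f_uv], which is the second
    fundamental form (lemmas [deriv_sandwich], [first_form_surface],
    [second_form_surface]).

    The curvature is computed intrinsically.  Equality of the mixed second
    derivatives of the frame ([derive_comm]) at the two parameters [1] and [2]
    separates the powers of lambda and yields [structure_equations].  Identify
    [p] with the complex plane by [e1 = 1], [e2 = i], and let
    [alpha_0 = (s du + t dv) e3]; since [ad e3] acts as multiplication by [2i],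
    these equations say that the connection [D = d + 2i (s du + t dv)] satisfies
    [D_v B1 = 0], [D_u B_-1 = 0] and [s_v - t_u = 2 (B1 x B_-1)], where [x] is the
    cross product of the plane.  Thus [D_v X = D_u Y = 0], so that the metric
    connection [D], carried to the surface by the frame [X], [Y], is torsion-free
    and therefore the Levi-Civita connection.  Comparing its curvature
    [2i (t_u - s_v)] with [- K i (X x Y)] gives ([gauss_curvature_moving_frame])
    [K = 4 / ((mu - 1) (mu^-1 - 1)) = - 4 mu / (mu - 1)^2 = 1 - rho^2]. *)

Set Implicit Arguments.
Unset Strict Implicit.
Unset Printing Implicit Defensive.

(** * Calculus of smooth real functions *)

Section SmoothCalculus.
Context {R : realType}.
Implicit Types V W : normedModType R.

Lemma open_near_eq V (D : set V) (openD : open D) (T : Type) (f g : V -> T) :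
  (forall x, D x -> f x = g x) -> forall x, D x -> {near x, f =1 g}.
Proof.
by move=> fg x Dx; near=> y; apply: fg; near: y; exact: open_nbhs_nbhs.
Unshelve. all: by end_near. Qed.

(** The Leibniz formulas hold only on [D], while the iterated derivatives in
    [is_Ck] are functions on the whole space; this lemma bridges the gap, as
    derivatives at a point of the open set [D] only depend on values in [D]. *)
Lemma is_Ck_eq V (D : set V) (openD : open D) k (f g : V -> R) :
  (forall x, D x -> f x = g x) -> is_Ck k D f -> is_Ck k D g.
Proof.
elim: k f g => [|k IH] f g fg [cf df].
all: have cg x : D x -> {for x, continuous g} by
  move=> Dx; rewrite /prop_for /continuous_at -fg//;
  apply: cvg_trans (cf x Dx); exact/near_eq_cvg/(open_near_eq openD).
  by split.
split=> // v; have [dfv Ckf] := df v; split.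
  move=> x Dx; apply: near_eq_derivable (dfv x Dx).
  exact: (open_near_eq openD).
apply: IH Ckf => x Dx; apply: near_eq_derive.
exact: (open_near_eq openD).
Qed.

Lemma is_Ck_pred V (D : set V) k (f : V -> R) : is_Ck k.+1 D f -> is_Ck k D f.
Proof.
elim: k f => [|k IH] f /= [cf df]; split=> // v.
by have [dfv Ckf] := df v; split=> //; exact: IH.
Qed.

Lemma is_CkD V (D : set V) (openD : open D) k (f g : V -> R) :
  is_Ck k D f -> is_Ck k D g -> is_Ck k D (fun x => f x + g x).
Proof.
elim: k f g => [|k IH] f g /= [cf df] [cg dg]; split=> //.
- by move=> x Dx; apply: continuousD; [exact: cf | exact: cg].
- by move=> x Dx; apply: continuousD; [exact: cf | exact: cg].
- move=> v; have [dfv Ckf] := df v; have [dgv Ckg] := dg v; split.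
    by move=> x Dx; apply: derivableD; [exact: dfv | exact: dgv].
  apply: is_Ck_eq (IH _ _ Ckf Ckg) => // x Dx.
  by apply/esym/deriveD; [exact: dfv | exact: dgv].
Qed.

Lemma is_CkN V (D : set V) (openD : open D) k (f : V -> R) :
  is_Ck k D f -> is_Ck k D (fun x => - f x).
Proof.
elim: k f => [|k IH] f /= [cf df]; split=> //.
- by move=> x Dx; apply: continuousN; exact: cf.
- by move=> x Dx; apply: continuousN; exact: cf.
- move=> v; have [dfv Ckf] := df v; split.
    by move=> x Dx; apply: derivableN; exact: dfv.
  apply: is_Ck_eq (IH _ Ckf) => // x Dx.
  by apply/esym/deriveN; exact: dfv.
Qed.

Lemma is_CkM V (D : set V) (openD : open D) k (f g : V -> R) :
  is_Ck k D f -> is_Ck k D g -> is_Ck k D (fun x => f x * g x).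
Proof.
elim: k f g => [|k IH] f g Ckf Ckg; have [cf df] := Ckf;
  have [cg dg] := Ckg; split=> //.
- by move=> x Dx; apply: continuousM; [exact: cf | exact: cg].
- by move=> x Dx; apply: continuousM; [exact: cf | exact: cg].
- move=> v; have [dfv Ckdf] := df v; have [dgv Ckdg] := dg v; split.
    by move=> x Dx; apply: derivableM; [exact: dfv | exact: dgv].
  apply: (is_Ck_eq openD (f := fun x => f x * 'D_v g x + g x * 'D_v f x)).
    by move=> x Dx; apply/esym/deriveM; [exact: dfv | exact: dgv].
  by apply: is_CkD => //; apply: IH => //; exact: is_Ck_pred.
Qed.

Lemma is_CkV V (D : set V) (openD : open D) k (f : V -> R) :
  (forall x, D x -> f x != 0) -> is_Ck k D f -> is_Ck k D (fun x => (f x)^-1).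
Proof.
move=> f0; elim: k => [|k IH] Ckf; have [cf df] := Ckf; split=> //.
- by move=> x Dx; apply: cvgV; [exact: f0 | exact: cf].
- by move=> x Dx; apply: cvgV; [exact: f0 | exact: cf].
- move=> v; have [dfv Ckdf] := df v; split.
    by move=> x Dx; apply: derivableV; [exact: f0 | exact: dfv].
  apply: (is_Ck_eq openD (f := fun x => - ((f x)^-1 * (f x)^-1 * 'D_v f x))).
    move=> x Dx; rewrite [RHS]deriveV; [|exact: f0|exact: dfv].
    by rewrite -exprVn expr2 scaleNr.
  have Ckf' := IH (is_Ck_pred Ckf).
  by apply: is_CkN => //; apply: is_CkM => //; exact: is_CkM.
Qed.

Lemma smooth_derivable V (D : set V) (f : V -> R) v x :
  smooth D f -> D x -> derivable f x v.
Proof. by move=> /(_ 1%N)[_ /(_ v)[df _]]; exact: df. Qed.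

Lemma smooth_cont V (D : set V) (f : V -> R) x :
  smooth D f -> D x -> {for x, continuous f}.
Proof. by move=> /(_ 0%N)[cf _]; exact: cf. Qed.

Lemma smooth_derive V (D : set V) (f : V -> R) v :
  smooth D f -> smooth D ('D_v f).
Proof. by move=> sf k; have [_ /(_ v)[]] := sf k.+1. Qed.

Lemma smooth_eq V (D : set V) (openD : open D) (f g : V -> R) :
  (forall x, D x -> f x = g x) -> smooth D f -> smooth D g.
Proof. by move=> fg sf k; exact: is_Ck_eq (sf k). Qed.

Lemma smoothD V (D : set V) (openD : open D) (f g : V -> R) :
  smooth D f -> smooth D g -> smooth D (fun x => f x + g x).
Proof. by move=> sf sg k; exact: is_CkD. Qed.

Lemma smoothN V (D : set V) (openD : open D) (f : V -> R) :
  smooth D f -> smooth D (fun x => - f x).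
Proof. by move=> sf k; exact: is_CkN. Qed.

Lemma smoothM V (D : set V) (openD : open D) (f g : V -> R) :
  smooth D f -> smooth D g -> smooth D (fun x => f x * g x).
Proof. by move=> sf sg k; exact: is_CkM. Qed.

Lemma smooth_cst V (D : set V) (c : R) : smooth D (fun=> c).
Proof.
move=> k; elim: k c => [|k IH] c /=; split=> //.
- by move=> x _; exact: cvg_cst.
- by move=> x _; exact: cvg_cst.
move=> v; split=> [x _|]; first exact: derivable_cst.
have -> : 'D_v (fun=> c) = (fun=> 0) :> (V -> R).
  by apply/funext => x; exact: derive_cst.
exact: IH.
Qed.

Lemma smooth_derive_eq V (D : set V) (openD : open D) (f g : V -> R) v x :
  (forall y, D y -> f y = g y) -> D x -> 'D_v f x = 'D_v g x.
Proof. by move=> fg Dx; apply: near_eq_derive; exact: (open_near_eq openD). Qed.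

Lemma smooth_deriveD V (D : set V) (f g : V -> R) v x :
  smooth D f -> smooth D g -> D x ->
  'D_v (fun y => f y + g y) x = 'D_v f x + 'D_v g x.
Proof.
move=> sf sg Dx; apply: deriveD; [exact: smooth_derivable sf Dx|].
exact: smooth_derivable sg Dx.
Qed.

Lemma smooth_deriveN V (D : set V) (f : V -> R) v x :
  smooth D f -> D x -> 'D_v (fun y => - f y) x = - 'D_v f x.
Proof. by move=> sf Dx; apply: deriveN; exact: smooth_derivable sf Dx. Qed.

Lemma smooth_deriveM V (D : set V) (f g : V -> R) v x :
  smooth D f -> smooth D g -> D x ->
  'D_v (fun y => f y * g y) x = 'D_v f x * g x + f x * 'D_v g x.
Proof.
move=> sf sg Dx; rewrite [LHS]deriveM; last 2 first.
- exact: smooth_derivable sf Dx.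
- exact: smooth_derivable sg Dx.
by rewrite addrC; congr (_ + _); exact: mulrC.
Qed.

Lemma smooth_deriveZ V (D : set V) (f : V -> R) c v x :
  smooth D f -> D x -> 'D_v (fun y => c * f y) x = c * 'D_v f x.
Proof.
move=> sf Dx; rewrite (smooth_deriveM _ (@smooth_cst V D c) sf Dx).
by rewrite derive_cst mul0r add0r.
Qed.

Lemma smoothV V (D : set V) (openD : open D) (f : V -> R) :
  (forall x, D x -> f x != 0) -> smooth D f -> smooth D (fun x => (f x)^-1).
Proof. by move=> f0 sf k; exact: is_CkV. Qed.

(** The derivative of the slice along [v] is the slice of the derivative along
    [(v, 0)]. *)
Lemma smooth_slice V W (E : set (V * W)) (D : set V) (f : V * W -> R) (z : W) :
  (forall x, D x -> E (x, z)) -> smooth E f -> smooth D (fun x => f (x, z)).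
Proof.
move=> DE sf k; have {sf} := sf k.
have cslice (g : V * W -> R) : (forall q, E q -> {for q, continuous g}) ->
    forall x, D x -> {for x, continuous (fun x => g (x, z))}.
  move=> cg x Dx; apply: continuous_comp; last exact/cg/DE.
  by apply: cvg_pair => /=; [exact: cvg_id | exact: cvg_cst].
elim: k f => [|k IH] f /= [cf df]; first by split=> //; exact: cslice.
split; first exact: cslice.
move=> v.
have quotE x : (fun h : R => h^-1 *: (f (h *: v + x, z) - f (x, z))) =
               (fun h : R => h^-1 *: (f (h *: (v, 0) + (x, z)) - f (x, z))).
  by apply/funext => h; congr (_ *: (f _ - _)); congr (_, _);
     rewrite /= scaler0 add0r.
have [dfv Ckf] := df (v, 0); split.
  by move=> x Dx; rewrite /derivable /= quotE; exact/dfv/DE.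
have -> : 'D_v (fun x => f (x, z)) = (fun x => 'D_(v, 0) f (x, z)).
  by apply/funext => x; rewrite /derive /= quotE.
exact: (IH ('D_(v, 0) f)).
Qed.

Lemma is_derive_line V (f : V -> R) (a v : V) (s : R) :
  derivable f (s *: v + a) v ->
  is_derive s 1 (fun t : R => f (t *: v + a)) ('D_v f (s *: v + a)).
Proof.
move=> df.
have quotE : (fun h : R => h^-1 *: (f ((h *: 1 + s) *: v + a) - f (s *: v + a)))
   = (fun h : R => h^-1 *: (f (h *: v + (s *: v + a)) - f (s *: v + a))).
  by apply/funext => h; rewrite [h *: 1]mulr1 scalerDl addrA.
by split; rewrite /derivable /derive /= quotE.
Qed.

(** The mean value theorem is used twice: for the difference in direction [w]
    as a function of the position along [v], and then for ['D_v f] as a function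
    of the position along [w]. *)
Lemma second_difference_MVT V (f : V -> R) (p v w : V) (h : R) : 0 < h ->
  (forall s t, 0 <= s <= h -> 0 <= t <= h ->
     derivable f (s *: v + (t *: w + p)) v /\
     derivable ('D_v f) (s *: v + (t *: w + p)) w) ->
  exists s t, [/\ 0 <= s <= h, 0 <= t <= h &
    f (h *: v + (h *: w + p)) - f (h *: v + p) - f (h *: w + p) + f p =
    h ^+ 2 * 'D_w ('D_v f) (s *: v + (t *: w + p))].
Proof.
move=> h0 df.
have le_h : 0 <= h <= h by rewrite lexx ltW.
have le_0 : (0 : R) <= 0 <= h by rewrite lexx ltW.
pose phi := (fun s : R => f (s *: v + (h *: w + p))) -
            (fun s : R => f (s *: v + p)).
have dphi (s : R) : 0 <= s <= h ->
    is_derive s 1 phi ('D_v f (s *: v + (h *: w + p)) - 'D_v f (s *: v + p)).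
  move=> sh; apply: is_deriveB; apply: is_derive_line.
    exact: (df s h sh le_h).1.
  by have [+ _] := df s 0 sh le_0; rewrite scale0r add0r; apply.
have cphi : {within `[0, h], continuous phi}.
  by apply: derivable_within_continuous => x xh; apply: ex_derive; exact: dphi.
have [s] := MVT_segment (ltW h0)
  (fun x xh => dphi x (subset_itv_oo_cc xh)) cphi.
rewrite in_itv /= => sh Es.
have dpsi (t : R) : 0 <= t <= h ->
    is_derive t 1 (fun t => 'D_v f (t *: w + (s *: v + p)))
      ('D_w ('D_v f) (t *: w + (s *: v + p))).
  by move=> th; apply: is_derive_line; rewrite addrCA; have [] := df s t sh th.
have cpsi : {within `[0, h], continuous (fun t => 'D_v f (t *: w + (s *: v + p)))}.
  by apply: derivable_within_continuous => x xh; apply: ex_derive; exact: dpsi.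
have [t] := MVT_segment (ltW h0)
  (fun x xh => dpsi x (subset_itv_oo_cc xh)) cpsi.
rewrite in_itv /= => th Et.
exists s, t; split=> //.
move: Es Et; rewrite /phi !subr0 !scale0r !add0r.
rewrite -![(_ - _ : _ -> _) _]/(_ - _) !scale0r !add0r.
rewrite ![_ *: w + (s *: v + _)]addrCA => Es Et.
move: Es; rewrite Et opprB addrA => Es.
by rewrite -[RHS]mulrC mulrA -Es; ring.
Qed.

(** Symmetry of second derivatives.  The second difference is symmetric in [v]
    and [w], so by [second_difference_MVT] the two mixed derivatives take a
    common value, at possibly different points, on every small parallelogram at
    [p]; both are continuous. *)
Lemma derive_comm V (D : set V) (openD : open D) (f : V -> R) v w p :
  smooth D f -> D p -> 'D_v ('D_w f) p = 'D_w ('D_v f) p.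
Proof.
move=> sf Dp.
have cvw := smooth_cont (smooth_derive v (smooth_derive w sf)) Dp.
have cwv := smooth_cont (smooth_derive w (smooth_derive v sf)) Dp.
apply/eqP; rewrite -subr_eq0 -normr_le0; apply/ler_addgt0Pr => e e0; rewrite add0r.
have e2 : 0 < e / 2 by rewrite divr_gt0.
have nD : nbhs p D by apply: open_nbhs_nbhs; split.
have nvw : \forall x \near p, `|'D_v ('D_w f) p - 'D_v ('D_w f) x| < e / 2.
  exact: (proj1 (cvgrPdist_lt _ _) cvw _ e2).
have nwv : \forall x \near p, `|'D_w ('D_v f) p - 'D_w ('D_v f) x| < e / 2.
  exact: (proj1 (cvgrPdist_lt _ _) cwv _ e2).
have [d /= d0 Bd] := proj1 (nbhs_ballP _ _) (filterI nD (filterI nvw nwv)).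
(* [+ 1] makes the denominator positive even for [v = w = 0] *)
pose h := d / (`|v| + `|w| + 1).
have den0 : 0 < `|v| + `|w| + 1 by rewrite ltr_wpDl// addr_ge0.
have h0 : 0 < h by rewrite divr_gt0.
have hd s t : 0 <= s <= h -> 0 <= t <= h -> ball p d (s *: v + (t *: w + p)).
  move=> /andP[s0 sh] /andP[t0 th].
  rewrite -ball_normE /= addrA opprD addrCA subrr addr0 normrN.
  apply: (@le_lt_trans _ _ (h * (`|v| + `|w|))).
    rewrite (le_trans (ler_normD _ _))// !normrZ !ger0_norm// mulrDr.
    by rewrite lerD// ler_wpM2r.
  by rewrite /h mulrAC ltr_pdivrMr// ltr_pM2l// ltrDl.
have [|s [t [sh th E1]]] := @second_difference_MVT V f p v w h h0.
  move=> s t sh th; have [Dx _] := Bd _ (hd s t sh th).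
  split; apply: smooth_derivable Dx => //; exact: smooth_derive.
have [|s' [t' [sh' th' E2]]] := @second_difference_MVT V f p w v h h0.
  move=> s' t' sh' th'; rewrite (addrCA (s' *: w)); have [Dx _] := Bd _ (hd t' s' th' sh').
  split; apply: smooth_derivable Dx => //; exact: smooth_derive.
have {E1 E2} E : 'D_w ('D_v f) (s *: v + (t *: w + p)) =
                 'D_v ('D_w f) (t' *: v + (s' *: w + p)).
  apply: (@mulfI _ (h ^+ 2)); first by rewrite expf_neq0// gt_eqF.
  move: E2; rewrite (addrCA (t' *: v)) (addrCA (h *: w)) => E2.
  by rewrite -[LHS]E1 -[RHS]E2; ring.
have [_ [_ A1]] := Bd _ (hd s t sh th).
have [_ [A2 _]] := Bd _ (hd t' s' th' sh').
move: A1 A2; rewrite -E; clear.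
move: ('D_w ('D_v f) (s *: v + (t *: w + p))) => a.
move: ('D_v ('D_w f) p) ('D_w ('D_v f) p) => b c A1 A2.
rewrite -[b - c](subrKA a) (splitr e) (le_trans (ler_normD _ _))//.
by rewrite lerD// ltW// distrC.
Qed.

End SmoothCalculus.

(** * Two-by-two matrices *)

Lemma ord2P (i : 'I_2) : i = 0 \/ i = 1.
Proof. by case: i => [[|[|//]] ik]; [left|right]; exact: val_inj. Qed.

Lemma sum_I2 (W : nmodType) (f : 'I_2 -> W) : \sum_k f k = f 0 + f 1.
Proof.
rewrite !big_ord_recl big_ord0 addr0; congr (f _ + f _); exact: val_inj.
Qed.

Lemma det_mx22 (C : comPzRingType) (A : 'M[C]_2) :
  \det A = A 0 0 * A 1 1 - A 0 1 * A 1 0.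
Proof.
rewrite (expand_det_row _ 0) sum_I2 /cofactor !det_mx11 !mxE /=.
rewrite /bump /= expr0 expr1 mul1r mulN1r mulrN.
by congr (_ * A _ _ - _ * A _ _); apply: val_inj.
Qed.

Lemma eq_mx22 (T : Type) (X Y : 'M[T]_2) :
  X 0 0 = Y 0 0 -> X 0 1 = Y 0 1 -> X 1 0 = Y 1 0 -> X 1 1 = Y 1 1 -> X = Y.
Proof.
move=> E00 E01 E10 E11.
by apply/matrixP => i j; have [->|->] := ord2P i; have [->|->] := ord2P j.
Qed.

(** * Curvature of a metric given by a moving frame *)

Section Curvature.
Context {R : realType}.

(** Lowering the upper index cancels the inverse metric, which leaves a linear
    system for the Christoffel symbols instead of a formula with [invmx]. *)
Lemma christoffel_lower (g : R * R -> 'M[R]_2) p (l i j : 'I_2) :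
  g p \in unitmx ->
  \sum_k g p l k * christoffel g k i j p =
  2^-1 * (dg g i j l p + dg g j i l p - dg g l i j p).
Proof.
move=> gu; pose b : 'cV[R]_2 :=
  \col_m (2^-1 * (dg g i j m p + dg g j i m p - dg g m i j p)).
have chE k : christoffel g k i j p = (invmx (g p) *m b) k 0.
  rewrite /christoffel mulr_sumr mxE; apply: eq_bigr => m _.
  by rewrite mxE mulrCA mulrA.
transitivity ((g p *m (invmx (g p) *m b)) l 0).
  by rewrite mxE; apply: eq_bigr => k _; rewrite chE.
by rewrite mulmxA mulmxV// mul1mx mxE.
Qed.

(** The two equations say that [c0 x + c1 y - w] is orthogonal to [x] and to
    [y], hence zero; what remains is the rule of Cramer. *)
Lemma solve_2x2 (x1 x2 y1 y2 w1 w2 c0 c1 : R) :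
  x1 * y2 - x2 * y1 != 0 ->
  (x1 * x1 + x2 * x2) * c0 + (x1 * y1 + x2 * y2) * c1 = x1 * w1 + x2 * w2 ->
  (x1 * y1 + x2 * y2) * c0 + (y1 * y1 + y2 * y2) * c1 = y1 * w1 + y2 * w2 ->
  c0 = (w1 * y2 - w2 * y1) / (x1 * y2 - x2 * y1) /\
  c1 = (x1 * w2 - x2 * w1) / (x1 * y2 - x2 * y1).
Proof.
move=> d0 E0 E1.
have F1 : (x1 * y2 - x2 * y1) * (c0 * x1 + c1 * y1 - w1) = 0.
  have -> : (x1 * y2 - x2 * y1) * (c0 * x1 + c1 * y1 - w1) =
    y2 * ((x1 * x1 + x2 * x2) * c0 + (x1 * y1 + x2 * y2) * c1) -
    x2 * ((x1 * y1 + x2 * y2) * c0 + (y1 * y1 + y2 * y2) * c1) -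
    (x1 * y2 - x2 * y1) * w1 by ring.
  by rewrite E0 E1; ring.
have F2 : (x1 * y2 - x2 * y1) * (c0 * x2 + c1 * y2 - w2) = 0.
  have -> : (x1 * y2 - x2 * y1) * (c0 * x2 + c1 * y2 - w2) =
    x1 * ((x1 * y1 + x2 * y2) * c0 + (y1 * y1 + y2 * y2) * c1) -
    y1 * ((x1 * x1 + x2 * x2) * c0 + (x1 * y1 + x2 * y2) * c1) -
    (x1 * y2 - x2 * y1) * w2 by ring.
  by rewrite E0 E1; ring.
move/eqP: F1; rewrite mulf_eq0 (negbTE d0) subr_eq0 /= => /eqP <-.
move/eqP: F2; rewrite mulf_eq0 (negbTE d0) subr_eq0 /= => /eqP <-.
by split; field.
Qed.

Variables (M : set (R * R)) (openM : open M).
Variables (x1 x2 y1 y2 s t : R * R -> R).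
Hypotheses (sx1 : smooth M x1) (sx2 : smooth M x2).
Hypotheses (sy1 : smooth M y1) (sy2 : smooth M y2).
Hypotheses (ss : smooth M s) (st : smooth M t).
Local Notation U := (dir 0 : R * R).
Local Notation V := (dir 1 : R * R).
(** In the plane seen as the complex numbers, [x] and [y] are the images of the
    two coordinate fields under a bundle isometry, and [D = d + 2i (s du + t dv)]
    is the connection.  The next four hypotheses say [D_V x = 0] and [D_U y = 0]:
    the connection is torsion-free. *)
Hypothesis xv1 : forall p, M p -> 'D_V x1 p = 2 * t p * x2 p.
Hypothesis xv2 : forall p, M p -> 'D_V x2 p = - (2 * t p * x1 p).
Hypothesis yu1 : forall p, M p -> 'D_U y1 p = 2 * s p * y2 p.
Hypothesis yu2 : forall p, M p -> 'D_U y2 p = - (2 * s p * y1 p).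
(** The curvature of [D] is [2i (t_u - s_v)]; [curv] makes it [- i K] times the
    area form of the metric. *)
Variable K : R.
Hypothesis curv : forall p, M p -> 'D_V s p - 'D_U t p =
  K / 2 * (x1 p * y2 p - x2 p * y1 p).
Hypothesis indep : forall p, M p -> x1 p * y2 p - x2 p * y1 p != 0.
Variable g : R * R -> 'M[R]_2.
Hypothesis g00 : forall p, M p -> g p 0 0 = x1 p * x1 p + x2 p * x2 p.
Hypothesis g01 : forall p, M p -> g p 0 1 = x1 p * y1 p + x2 p * y2 p.
Hypothesis g10 : forall p, M p -> g p 1 0 = x1 p * y1 p + x2 p * y2 p.
Hypothesis g11 : forall p, M p -> g p 1 1 = y1 p * y1 p + y2 p * y2 p.

Lemma det_gram p : M p -> \det (g p) = (x1 p * y2 p - x2 p * y1 p) ^+ 2.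
Proof. by move=> Mp; rewrite det_mx22 g00// g01// g10// g11//; ring. Qed.

Lemma gram_unit p : M p -> g p \in unitmx.
Proof.
by move=> Mp; rewrite unitmxE det_gram// unitfE expf_neq0// indep.
Qed.

Lemma derive_dot (f1 f2 h1 h2 : R * R -> R) v p :
  smooth M f1 -> smooth M f2 -> smooth M h1 -> smooth M h2 -> M p ->
  'D_v (fun q => f1 q * h1 q + f2 q * h2 q) p =
  'D_v f1 p * h1 p + f1 p * 'D_v h1 p + ('D_v f2 p * h2 p + f2 p * 'D_v h2 p).
Proof.
move=> sf1 sf2 sh1 sh2 Mp.
rewrite (smooth_deriveD _ (smoothM openM sf1 sh1) (smoothM openM sf2 sh2) Mp).
by rewrite (smooth_deriveM _ sf1 sh1 Mp) (smooth_deriveM _ sf2 sh2 Mp).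
Qed.

Let dg00 i p : M p ->
  dg g i 0 0 p = 2 * (x1 p * 'D_(dir i) x1 p + x2 p * 'D_(dir i) x2 p).
Proof.
move=> Mp; rewrite /dg (smooth_derive_eq openM _ g00 Mp) derive_dot//.
ring.
Qed.

Let dg11 i p : M p ->
  dg g i 1 1 p = 2 * (y1 p * 'D_(dir i) y1 p + y2 p * 'D_(dir i) y2 p).
Proof.
move=> Mp; rewrite /dg (smooth_derive_eq openM _ g11 Mp) derive_dot//.
ring.
Qed.

Let dg01 i p : M p ->
  dg g i 0 1 p = x1 p * 'D_(dir i) y1 p + x2 p * 'D_(dir i) y2 p +
                 (y1 p * 'D_(dir i) x1 p + y2 p * 'D_(dir i) x2 p).
Proof.
move=> Mp; rewrite /dg (smooth_derive_eq openM _ g01 Mp) derive_dot//.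
ring.
Qed.

Let dg10 i p : M p ->
  dg g i 1 0 p = x1 p * 'D_(dir i) y1 p + x2 p * 'D_(dir i) y2 p +
                 (y1 p * 'D_(dir i) x1 p + y2 p * 'D_(dir i) x2 p).
Proof.
move=> Mp; rewrite /dg (smooth_derive_eq openM _ g10 Mp) derive_dot//.
ring.
Qed.

(** By [christoffel_lower], the combination of [x] and [y] with the Christoffel
    symbols as coefficients has the same inner products with the frame as [w];
    below, [w] is the derivative by [D] of a frame vector. *)
Lemma christoffel_frame (i j : 'I_2) (w1 w2 : R) p : M p ->
  2^-1 * (dg g i j 0 p + dg g j i 0 p - dg g 0 i j p) = x1 p * w1 + x2 p * w2 ->
  2^-1 * (dg g i j 1 p + dg g j i 1 p - dg g 1 i j p) = y1 p * w1 + y2 p * w2 ->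
  christoffel g 0 i j p = (w1 * y2 p - w2 * y1 p) / (x1 p * y2 p - x2 p * y1 p)
  /\
  christoffel g 1 i j p = (x1 p * w2 - x2 p * w1) / (x1 p * y2 p - x2 p * y1 p).
Proof.
move=> Mp E0 E1; apply: solve_2x2 (indep Mp) _ _.
  by rewrite -E0 -(christoffel_lower _ _ _ (gram_unit Mp)) sum_I2 g00// g01.
by rewrite -E1 -(christoffel_lower _ _ _ (gram_unit Mp)) sum_I2 g10// g11.
Qed.

(** The frame vectors are parallel in the mixed directions, so [w = 0]. *)
Lemma christoffel01 p : M p ->
  christoffel g 0 0 1 p = 0 /\ christoffel g 1 0 1 p = 0.
Proof.
move=> Mp; have [||-> ->] := @christoffel_frame 0 1 0 0 p Mp.
- by rewrite ?dg10// ?dg00// ?dg01// xv1// xv2//; ring.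
- by rewrite ?dg11// ?dg01// ?dg10// yu1// yu2//; ring.
by rewrite !(mulr0, mul0r, subr0).
Qed.

(** [P = D_U x], [Q = D_V y], and [W] is the area form on the frame. *)
Let P1 p := 'D_U x1 p - 2 * s p * x2 p.
Let P2 p := 'D_U x2 p + 2 * s p * x1 p.
Let Q1 p := 'D_V y1 p - 2 * t p * y2 p.
Let Q2 p := 'D_V y2 p + 2 * t p * y1 p.
Let W p := x1 p * y2 p - x2 p * y1 p.

Lemma christoffel00 p : M p ->
  christoffel g 0 0 0 p = (P1 p * y2 p - P2 p * y1 p) / W p /\
  christoffel g 1 0 0 p = (x1 p * P2 p - x2 p * P1 p) / W p.
Proof.
move=> Mp; apply: christoffel_frame => //.
- by rewrite ?dg00// /P1 /P2; field.
- by rewrite ?dg00// ?dg01// yu1// yu2// xv1// xv2// /P1 /P2; field.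
Qed.

Lemma christoffel11 p : M p ->
  christoffel g 0 1 1 p = (Q1 p * y2 p - Q2 p * y1 p) / W p /\
  christoffel g 1 1 1 p = (x1 p * Q2 p - x2 p * Q1 p) / W p.
Proof.
move=> Mp; apply: christoffel_frame => //.
- by rewrite ?dg11// ?dg10// yu1// yu2// xv1// xv2// /Q1 /Q2; field.
- by rewrite ?dg11// /Q1 /Q2; field.
Qed.

Let smooth_W : smooth M W.
Proof.
rewrite /W; apply: (smoothD openM (smoothM openM sx1 sy2)).
exact: (smoothN openM (smoothM openM sx2 sy1)).
Qed.

Let smooth_Q1 : smooth M Q1.
Proof.
rewrite /Q1; apply: (smoothD openM (smooth_derive _ sy1)); apply: smoothN => //.
by apply: smoothM => //; apply: smoothM => //; exact: smooth_cst.
Qed.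

Let smooth_Q2 : smooth M Q2.
Proof.
rewrite /Q2; apply: (smoothD openM (smooth_derive _ sy2)).
by apply: smoothM => //; apply: smoothM => //; exact: smooth_cst.
Qed.

Let smooth_christoffel0 : smooth M (christoffel g 0 1 1).
Proof.
apply: (smooth_eq openM (fun p Mp => esym (christoffel11 Mp).1)).
apply: (smoothM openM _ (smoothV openM indep smooth_W)).
by apply: (smoothD openM); [|apply: (smoothN openM)]; exact: smoothM.
Qed.

Let smooth_christoffel1 : smooth M (christoffel g 1 1 1).
Proof.
apply: (smooth_eq openM (fun p Mp => esym (christoffel11 Mp).2)).
apply: (smoothM openM _ (smoothV openM indep smooth_W)).
by apply: (smoothD openM); [|apply: (smoothN openM)]; exact: smoothM.
Qed.

Let frame11_1 p : M p ->
  christoffel g 0 1 1 p * x1 p + christoffel g 1 1 1 p * y1 p = Q1 p.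
Proof.
move=> Mp; have [-> ->] := christoffel11 Mp.
by rewrite /W; field; exact: indep.
Qed.

Let frame11_2 p : M p ->
  christoffel g 0 1 1 p * x2 p + christoffel g 1 1 1 p * y2 p = Q2 p.
Proof.
move=> Mp; have [-> ->] := christoffel11 Mp.
by rewrite /W; field; exact: indep.
Qed.

(** Since [D_U y = 0], one has [D_U Q = D_U D_V y = [D_U, D_V] y], which is
    [- i K W y] by [curv]; this is its first coordinate. *)
Let derive_Q1 p : M p ->
  'D_U Q1 p = K * W p * y2 p + 2 * s p * Q2 p.
Proof.
move=> Mp.
have s2t : smooth M (fun q => 2 * t q).
  by apply: (smoothM openM) => //; exact: smooth_cst.
have s2s : smooth M (fun q => 2 * s q).
  by apply: (smoothM openM) => //; exact: smooth_cst.
have s2ty : smooth M (fun q => 2 * t q * y2 q) by exact: smoothM.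
rewrite (smooth_deriveD _ (smooth_derive _ sy1) (smoothN openM s2ty) Mp).
rewrite (smooth_deriveN _ s2ty Mp) (smooth_deriveM _ s2t sy2 Mp).
rewrite (smooth_deriveZ _ _ st Mp) (derive_comm openM U V sy1 Mp).
rewrite (smooth_derive_eq openM V yu1 Mp) (smooth_deriveM _ s2s sy2 Mp).
rewrite (smooth_deriveZ _ _ ss Mp) yu2//.
have -> : K * W p = 2 * ('D_V s p - 'D_U t p) by rewrite curv// /W; field.
by rewrite /Q2; ring.
Qed.

Let derive_Q2 p : M p ->
  'D_U Q2 p = - (K * W p * y1 p) - 2 * s p * Q1 p.
Proof.
move=> Mp.
have s2t : smooth M (fun q => 2 * t q).
  by apply: (smoothM openM) => //; exact: smooth_cst.
have s2s : smooth M (fun q => 2 * s q).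
  by apply: (smoothM openM) => //; exact: smooth_cst.
have s2ty : smooth M (fun q => 2 * t q * y1 q) by exact: smoothM.
have s2sy : smooth M (fun q => 2 * s q * y1 q) by exact: smoothM.
rewrite (smooth_deriveD _ (smooth_derive _ sy2) s2ty Mp).
rewrite (smooth_deriveM _ s2t sy1 Mp).
rewrite (smooth_deriveZ _ _ st Mp) (derive_comm openM U V sy2 Mp).
rewrite (smooth_derive_eq openM V yu2 Mp) (smooth_deriveN _ s2sy Mp).
rewrite (smooth_deriveM _ s2s sy1 Mp) (smooth_deriveZ _ _ ss Mp) yu1//.
have -> : K * W p = 2 * ('D_V s p - 'D_U t p) by rewrite curv// /W; field.
by rewrite /Q1; ring.
Qed.

(** The other terms vanish because the mixed Christoffel symbols do. *)
Lemma riemann_frame l p : M p ->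
  riemann g l 0 1 1 p = 'D_U (christoffel g l 1 1) p +
                        christoffel g l 0 0 p * christoffel g 0 1 1 p.
Proof.
move=> Mp; rewrite /riemann sum_I2.
have c01 q : M q -> christoffel g l 0 1 q = 0.
  move=> Mq; have [c0 c1] := christoffel01 Mq.
  by have [->|->] := ord2P l.
have -> : 'D_V (christoffel g l 0 1) p = 0.
  by rewrite (smooth_derive_eq openM V c01 Mp) derive_cst.
have [c0 c1] := christoffel01 Mp.
by rewrite c0 c1 c01//; ring.
Qed.

(** Apply [D_U] to the expansion of [Q] in the frame and expand [D_U x = P] in
    the frame as well: with [R^l] the components of the curvature tensor, this
    gives [R^0 x + R^1 y = D_U Q = - i K W y].  The inner product with [x] is the
    numerator of the Gauss curvature, and equals [K W ^ 2 = K det g]. *)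
Theorem gauss_curvature_moving_frame p : M p -> gauss_curvature g p = K.
Proof.
move=> Mp; rewrite /gauss_curvature sum_I2 !riemann_frame// det_gram// -/(W p).
have W0 : W p != 0 := indep Mp.
have := derive_Q1 Mp; rewrite -(smooth_derive_eq openM U frame11_1 Mp).
rewrite (derive_dot _ smooth_christoffel0 smooth_christoffel1 sx1 sy1 Mp) yu1//.
have := derive_Q2 Mp; rewrite -(smooth_derive_eq openM U frame11_2 Mp).
rewrite (derive_dot _ smooth_christoffel0 smooth_christoffel1 sx2 sy2 Mp) yu2//.
rewrite -frame11_1// -frame11_2//.
have P1E : P1 p = christoffel g 0 0 0 p * x1 p + christoffel g 1 0 0 p * y1 p.
  by have [-> ->] := christoffel00 Mp; rewrite /W; field.
have P2E : P2 p = christoffel g 0 0 0 p * x2 p + christoffel g 1 0 0 p * y2 p.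
  by have [-> ->] := christoffel00 Mp; rewrite /W; field.
have -> : 'D_U x1 p = P1 p + 2 * s p * x2 p by rewrite /P1; ring.
have -> : 'D_U x2 p = P2 p - 2 * s p * x1 p by rewrite /P2; ring.
rewrite g00// g01//; move: P1E P2E W0; rewrite /W.
(* [A], [G], [H]: [U]-derivatives of the symbols with lower indices 11, symbols
   with lower indices 00, symbols with lower indices 11 *)
move: ('D_U (christoffel g 0 1 1) p) ('D_U (christoffel g 1 1 1) p) => A0 A1.
move: (christoffel g 0 0 0 p) (christoffel g 1 0 0 p) => G0 G1.
move: (christoffel g 0 1 1 p) (christoffel g 1 1 1 p) => H0 H1.
move: (P1 p) (P2 p) (x1 p) (x2 p) (y1 p) (y2 p) (s p) => ? ? a1 a2 b1 b2 c.
move=> -> -> W0 E2 E1.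
have E1' : (A0 + G0 * H0) * a1 + (A1 + G1 * H0) * b1 =
           K * (a1 * b2 - a2 * b1) * b2 by lra.
have E2' : (A0 + G0 * H0) * a2 + (A1 + G1 * H0) * b2 =
           - (K * (a1 * b2 - a2 * b1) * b1) by lra.
apply: (@mulIf _ ((a1 * b2 - a2 * b1) ^+ 2)); first by rewrite expf_neq0.
rewrite divfK ?expf_neq0//.
transitivity (a1 * ((A0 + G0 * H0) * a1 + (A1 + G1 * H0) * b1) +
              a2 * ((A0 + G0 * H0) * a2 + (A1 + G1 * H0) * b2)); first by ring.
by rewrite E1' E2'; ring.
Qed.

End Curvature.

(** * Quaternions as complex matrices *)

Section Quaternions.
Context {R : realType}.
Local Notation Re := complex.Re.
Local Notation Im := complex.Im.
Implicit Types X Y F G W : 'M[R[i]]_2.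

(** The quaternion [a + b e3 + c e1 + d e2], in the order of the coordinates of
    the first row. *)
Definition quat (a b c d : R) : 'M[R[i]]_2 :=
  mx2 (a +i* b)%C (c +i* d)%C (- c +i* d)%C (a -i* b)%C.

Lemma eq_complexP (x y : R[i]) : Re x = Re y -> Im x = Im y -> x = y.
Proof. by case: x y => [a b] [c d] /= -> ->. Qed.

Lemma mx2E (a b c d : R[i]) :
  (mx2 a b c d 0 0 = a) * (mx2 a b c d 0 1 = b) *
  (mx2 a b c d 1 0 = c) * (mx2 a b c d 1 1 = d).
Proof. by rewrite /mx2 !mxE. Qed.

Lemma quatM a b c d a' b' c' d' :
  quat a b c d *m quat a' b' c' d' =
  quat (a * a' - b * b' - c * c' - d * d')
       (a * b' + b * a' + c * d' - d * c')
       (a * c' - b * d' + c * a' + d * b')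
       (a * d' + b * c' - c * b' + d * a').
Proof.
apply: eq_mx22; rewrite [LHS]mxE sum_I2 !mx2E; apply: eq_complexP => /=; ring.
Qed.

Lemma quatD a b c d a' b' c' d' :
  quat a b c d + quat a' b' c' d' = quat (a + a') (b + b') (c + c') (d + d').
Proof. by apply: eq_mx22; rewrite [LHS]mxE !mx2E; apply: eq_complexP => /=; ring. Qed.

Lemma quatN a b c d : - quat a b c d = quat (- a) (- b) (- c) (- d).
Proof. by apply: eq_mx22; rewrite [LHS]mxE !mx2E; apply: eq_complexP => /=; ring. Qed.

Lemma rsc_quat k a b c d : rsc k (quat a b c d) = quat (k * a) (k * b) (k * c) (k * d).
Proof. by apply: eq_mx22; rewrite [LHS]mxE !mx2E; apply: eq_complexP => /=; ring. Qed.

Lemma quat_inj a b c d a' b' c' d' : quat a b c d = quat a' b' c' d' ->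
  [/\ a = a', b = b', c = c' & d = d'].
Proof.
move=> E; have := congr1 (fun X : 'M[R[i]]_2 => X 0 0) E.
by have := congr1 (fun X : 'M[R[i]]_2 => X 0 1) E; rewrite !mx2E => -[-> ->] [-> ->].
Qed.

Lemma quat0 : 0 = quat 0 0 0 0.
Proof. by apply: eq_mx22; rewrite [LHS]mxE !mx2E; apply: eq_complexP => /=; ring. Qed.

Lemma e3_quat : e3 = quat 0 1 0 0.
Proof. by apply: eq_mx22; rewrite !mx2E; apply: eq_complexP => /=; ring. Qed.

Lemma in_k_quat X : in_k X <-> X = quat 0 (Im (X 0 0)) 0 0.
Proof.
split=> [[a ->]|->]; last by eexists; rewrite e3_quat rsc_quat mulr1 mulr0.
by rewrite e3_quat rsc_quat !mx2E /= !mulr0 mulr1.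
Qed.

Lemma p_quat c d : rsc c e1 + rsc d e2 = quat 0 0 c d.
Proof.
have -> : e1 = quat 0 0 1 0.
  by apply: eq_mx22; rewrite !mx2E; apply: eq_complexP => /=; ring.
have -> : e2 = quat 0 0 0 1.
  by apply: eq_mx22; rewrite !mx2E; apply: eq_complexP => /=; ring.
by rewrite !rsc_quat quatD; congr quat; ring.
Qed.

Lemma in_p_quat X : in_p X -> X = quat 0 0 (Re (X 0 1)) (Im (X 0 1)).
Proof. by move=> [c [d ->]]; rewrite p_quat !mx2E. Qed.

Lemma adjointM X Y : adjoint (X *m Y) = adjoint Y *m adjoint X.
Proof. by rewrite /adjoint trmx_mul map_mxM. Qed.

Lemma adjointK X : adjoint (adjoint X) = X.
Proof. by apply/matrixP => i j; rewrite !mxE conjcK. Qed.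

Lemma adjoint_quat a b c d :
  adjoint (quat a b c d) = quat a (- b) (- c) (- d).
Proof.
by apply: eq_mx22; rewrite [LHS]mxE [X in conjc X]mxE !mx2E;
  apply: eq_complexP => /=; ring.
Qed.

Lemma su2_quat b c d : su2 (quat 0 b c d).
Proof.
split; first by rewrite /mxtrace sum_I2 !mx2E; apply: eq_complexP => /=; ring.
by rewrite adjoint_quat quatN; congr quat; ring.
Qed.

Lemma R4_ip_quat a b c d a' b' c' d' :
  R4_ip (quat a b c d) (quat a' b' c' d') = a * a' + b * b' + c * c' + d * d'.
Proof. by rewrite /R4_ip !mx2E. Qed.

Lemma su2_ip_quat b c d b' c' d' :
  su2_ip (quat 0 b c d) (quat 0 b' c' d') = b * b' + c * c' + d * d'.
Proof.
rewrite /su2_ip quatM /mxtrace sum_I2 !mx2E.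
have -> : (2^-1 : R[i]) = (2^-1)%:C%C by rewrite fmorphV rmorph_nat.
by rewrite /=; field.
Qed.

Lemma SU2_inv X : SU2 X -> invmx X = adjoint X.
Proof.
move=> [dX XX]; have uX : X \in unitmx by rewrite unitmxE dX unitr1.
by rewrite -[LHS]mul1mx -XX -mulmxA mulmxV// mulmx1.
Qed.

Lemma SU2_mulV X : SU2 X -> X *m adjoint X = 1%:M.
Proof.
by move=> SX; rewrite -SU2_inv// mulmxV// unitmxE (proj1 SX) unitr1.
Qed.

Lemma SU2_mul X Y : SU2 X -> SU2 Y -> SU2 (X *m Y).
Proof.
move=> [dX XX] [dY YY]; split; first by rewrite det_mulmx dX dY mulr1.
by rewrite adjointM -mulmxA (mulmxA _ X) XX mul1mx.
Qed.

Lemma SU2_adjoint X : SU2 X -> SU2 (adjoint X).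
Proof.
move=> SX; split; last by rewrite adjointK SU2_mulV.
by rewrite -SU2_inv// det_inv (proj1 SX) invr1.
Qed.

(** For determinant one the inverse is the adjugate; equating it with the
    adjoint leaves two free complex entries. *)
Lemma SU2_quat X : SU2 X -> exists a b c d,
  X = quat a b c d /\ a * a + b * b + c * c + d * d = 1.
Proof.
move=> SX; have XX := SU2_mulV SX; have [dX _] := SX.
pose N := mx2 (X 1 1) (- X 0 1) (- X 1 0) (X 0 0).
have NX : N *m X = 1%:M.
  by move: dX; rewrite det_mx22 => <-; apply: eq_mx22;
     rewrite [LHS]mxE [RHS]mxE sum_I2 !mx2E /= ?(mulr1n, mulr0n); ring.
have aX : adjoint X = N by rewrite -[LHS]mul1mx -NX -mulmxA XX mulmx1.
have X11 : X 1 1 = (conjc (X 0 0))%C.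
  by have /(congr1 (fun Y : 'M[R[i]]_2 => Y 0 0)) := aX; rewrite 2!mxE mx2E.
have X10 : X 1 0 = - (conjc (X 0 1))%C.
  have /(congr1 (fun Y : 'M[R[i]]_2 => Y 1 0)) := aX.
  by rewrite 2!mxE mx2E => ->; rewrite opprK.
exists (Re (X 0 0)), (Im (X 0 0)), (Re (X 0 1)), (Im (X 0 1)); split.
  apply: eq_mx22; rewrite !mx2E ?X11 ?X10 //;
    case: (X 0 0) (X 0 1) => [a b] [c d]; apply: eq_complexP => //=; ring.
have /(congr1 (@complex.Re R)) := dX; rewrite det_mx22 X11 X10.
by case: (X 0 0) => a b; case: (X 0 1) => c d /= <-; ring.
Qed.

(** Cyclic invariance of the trace. *)
Lemma su2_ip_conj F X Y : SU2 F ->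
  su2_ip (F *m X *m adjoint F) (F *m Y *m adjoint F) = su2_ip X Y.
Proof.
move=> SF; rewrite /su2_ip; congr (Re (_ * _)).
rewrite -!mulmxA mxtrace_mulC -!mulmxA (proj2 SF) mulmx1.
by rewrite !mulmxA -(mulmxA _ _ F) (proj2 SF) mulmx1.
Qed.

(** Left and right multiplication by a unit quaternion are isometries. *)
Lemma R4_ip_conj F a b c d a' b' c' d' : SU2 F ->
  R4_ip (F *m quat a b c d *m adjoint F) (F *m quat a' b' c' d' *m adjoint F) =
  R4_ip (quat a b c d) (quat a' b' c' d').
Proof.
move=> /SU2_quat[x [y [z [t [-> N1]]]]].
have ipl (k l m n k' l' m' n' : R) :
    R4_ip (quat x y z t *m quat k l m n) (quat x y z t *m quat k' l' m' n') =
    R4_ip (quat k l m n) (quat k' l' m' n').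
  rewrite !quatM !R4_ip_quat -[RHS]mul1r -N1; ring.
have ipr (k l m n k' l' m' n' : R) :
    R4_ip (quat k l m n *m quat x (- y) (- z) (- t))
          (quat k' l' m' n' *m quat x (- y) (- z) (- t)) =
    R4_ip (quat k l m n) (quat k' l' m' n').
  rewrite !quatM !R4_ip_quat -[RHS]mul1r -N1; ring.
by rewrite adjoint_quat !(quatM x y z t) ipr -!quatM ipl.
Qed.

End Quaternions.

(** * Derivatives of matrix-valued functions *)

Section MatrixCalculus.
Context {R : realType}.
Local Notation Re := complex.Re.
Local Notation Im := complex.Im.
Variables (V : normedModType R) (D : set V) (openD : open D).
Implicit Types (F G : V -> 'M[R[i]]_2) (f g : V -> R[i]).

Definition smoothc f := smooth D (fun x => Re (f x)) /\ smooth D (fun x => Im (f x)).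

Definition derivc v f x : R[i] :=
  ('D_v (fun y => Re (f y)) x +i* 'D_v (fun y => Im (f y)) x)%C.

Lemma deriv_mxE v F x i j : deriv_mx v F x i j = derivc v (fun y => F y i j) x.
Proof. by rewrite mxE. Qed.

Lemma ReM (x y : R[i]) : Re (x * y) = Re x * Re y + - (Im x * Im y).
Proof. by case: x y => [a b] [c d]. Qed.

Lemma ImM (x y : R[i]) : Im (x * y) = Re x * Im y + Im x * Re y.
Proof. by case: x y => [a b] [c d]. Qed.

Lemma smoothcD f g : smoothc f -> smoothc g -> smoothc (fun x => f x + g x).
Proof.
move=> [rf If] [rg Ig]; split.
  have -> : (fun x => Re (f x + g x)) = (fun x => Re (f x) + Re (g x)).
    by apply/funext => x; case: (f x) (g x) => [a b] [c d].
  exact: smoothD.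
have -> : (fun x => Im (f x + g x)) = (fun x => Im (f x) + Im (g x)).
  by apply/funext => x; case: (f x) (g x) => [a b] [c d].
exact: smoothD.
Qed.

Lemma smoothcM f g : smoothc f -> smoothc g -> smoothc (fun x => f x * g x).
Proof.
move=> [rf If] [rg Ig]; split.
  under eq_fun do rewrite ReM.
  by apply: smoothD; [| |apply: smoothN] => //; exact: smoothM.
under eq_fun do rewrite ImM.
by apply: smoothD => //; exact: smoothM.
Qed.

Lemma derivcD v f g x : smoothc f -> smoothc g -> D x ->
  derivc v (fun y => f y + g y) x = derivc v f x + derivc v g x.
Proof.
move=> [rf If] [rg Ig] Dx; apply: eq_complexP => /=.
  rewrite -(smooth_deriveD _ rf rg Dx); congr ('D_v _ x).
  by apply/funext => y; case: (f y) (g y) => [a b] [c d].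
rewrite -(smooth_deriveD _ If Ig Dx); congr ('D_v _ x).
by apply/funext => y; case: (f y) (g y) => [a b] [c d].
Qed.

Lemma derivcM v f g x : smoothc f -> smoothc g -> D x ->
  derivc v (fun y => f y * g y) x = derivc v f x * g x + f x * derivc v g x.
Proof.
move=> [rf If] [rg Ig] Dx; apply: eq_complexP.
  transitivity ('D_v (fun y => Re (f y) * Re (g y) + - (Im (f y) * Im (g y))) x).
    by congr ('D_v _ x); apply/funext => y; rewrite ReM.
  rewrite (smooth_deriveD _ (smoothM openD rf rg)
             (smoothN openD (smoothM openD If Ig)) Dx).
  rewrite (smooth_deriveN _ (smoothM openD If Ig) Dx).
  rewrite (smooth_deriveM _ rf rg Dx) (smooth_deriveM _ If Ig Dx).
  rewrite /derivc; case: (f x) (g x) => [a b] [c d] /=; ring.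
transitivity ('D_v (fun y => Re (f y) * Im (g y) + Im (f y) * Re (g y)) x).
  by congr ('D_v _ x); apply/funext => y; rewrite ImM.
rewrite (smooth_deriveD _ (smoothM openD rf Ig) (smoothM openD If rg) Dx).
rewrite (smooth_deriveM _ rf Ig Dx) (smooth_deriveM _ If rg Dx).
rewrite /derivc; case: (f x) (g x) => [a b] [c d] /=; ring.
Qed.

Lemma smooth_mxM F G : smooth_mx D F -> smooth_mx D G ->
  smooth_mx D (fun x => F x *m G x).
Proof.
move=> sF sG i j; rewrite -/(smoothc (fun x => (F x *m G x) i j)).
have -> : (fun x => (F x *m G x) i j) =
          (fun x => F x i 0 * G x 0 j + F x i 1 * G x 1 j).
  by apply/funext => x; rewrite mxE sum_I2.
by apply: smoothcD; apply: smoothcM; (exact: sF || exact: sG).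
Qed.

Lemma smooth_mxD F G : smooth_mx D F -> smooth_mx D G ->
  smooth_mx D (fun x => F x + G x).
Proof.
move=> sF sG i j; rewrite -/(smoothc (fun x => (F x + G x) i j)).
under eq_fun do rewrite mxE.
by apply: smoothcD; (exact: sF || exact: sG).
Qed.

Lemma smooth_mx_cst (C : 'M[R[i]]_2) : smooth_mx D (fun=> C).
Proof. by move=> i j; split; exact: smooth_cst. Qed.

Lemma smooth_mx_adjoint F : smooth_mx D F -> smooth_mx D (fun x => adjoint (F x)).
Proof.
move=> sF i j; have [rF IF] := sF j i; split.
  by apply: smooth_eq rF => // x _; rewrite !mxE; case: (F x j i).
by apply: smooth_eq (smoothN openD IF) => // x _; rewrite !mxE; case: (F x j i).
Qed.

Lemma smooth_mx_deriv v F : smooth_mx D F -> smooth_mx D (deriv_mx v F).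
Proof.
move=> sF i j; have [rF IF] := sF i j; split.
  by apply: smooth_eq (smooth_derive v rF) => // x _; rewrite deriv_mxE.
by apply: smooth_eq (smooth_derive v IF) => // x _; rewrite deriv_mxE.
Qed.

Lemma smooth_mx_eq F G : (forall x, D x -> F x = G x) ->
  smooth_mx D F -> smooth_mx D G.
Proof.
move=> FG sF i j; have [rF IF] := sF i j.
by split; [apply: smooth_eq rF|apply: smooth_eq IF] => // x Dx; rewrite FG.
Qed.

Lemma deriv_mx_eq v F G x : (forall y, D y -> F y = G y) -> D x ->
  deriv_mx v F x = deriv_mx v G x.
Proof.
move=> FG Dx; apply/matrixP => i j; rewrite !deriv_mxE /derivc.
by congr (_ +i* _)%C; apply: (smooth_derive_eq openD) => // y Dy; rewrite FG.
Qed.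

Lemma deriv_mx_cst (v x : V) (C : 'M[R[i]]_2) : deriv_mx v (fun=> C) x = 0.
Proof. by apply/matrixP => i j; rewrite !mxE !derive_cst. Qed.

Lemma deriv_mxM v F G x : smooth_mx D F -> smooth_mx D G -> D x ->
  deriv_mx v (fun y => F y *m G y) x =
  deriv_mx v F x *m G x + F x *m deriv_mx v G x.
Proof.
move=> sF sG Dx; apply/matrixP => i j.
rewrite [RHS]mxE [X in X + _]mxE [X in _ + X]mxE !sum_I2 !deriv_mxE.
transitivity (derivc v (fun y => F y i 0 * G y 0 j + F y i 1 * G y 1 j) x).
  by congr (derivc v _ x); apply/funext => y; rewrite mxE sum_I2.
rewrite (derivcD _ (smoothcM (sF i 0) (sG 0 j)) (smoothcM (sF i 1) (sG 1 j)) Dx).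
rewrite (derivcM _ (sF i 0) (sG 0 j) Dx) (derivcM _ (sF i 1) (sG 1 j) Dx).
by rewrite addrACA.
Qed.

Lemma deriv_mx_adjoint v F x : smooth_mx D F -> D x ->
  deriv_mx v (fun y => adjoint (F y)) x = adjoint (deriv_mx v F x).
Proof.
move=> sF Dx; apply/matrixP => i j; rewrite deriv_mxE !mxE.
have [rF IF] := sF j i; apply: eq_complexP => /=.
  by congr ('D_v _ x); apply/funext => y; rewrite !mxE; case: (F y j i).
rewrite -(smooth_deriveN _ IF Dx).
by congr ('D_v _ x); apply/funext => y; rewrite !mxE; case: (F y j i).
Qed.

Lemma deriv_mx_comm v w F x : smooth_mx D F -> D x ->
  deriv_mx v (deriv_mx w F) x = deriv_mx w (deriv_mx v F) x.
Proof.
move=> sF Dx; apply/matrixP => i j; have [rF IF] := sF i j.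
have dE (u u' : V) : deriv_mx u (deriv_mx u' F) x i j =
    ('D_u ('D_u' (fun y => Re (F y i j))) x +i*
     'D_u ('D_u' (fun y => Im (F y i j))) x)%C.
  rewrite deriv_mxE /derivc.
  by congr (_ +i* _)%C; congr ('D_u _ x); apply/funext => y; rewrite deriv_mxE.
apply: etrans (dE v w) _; apply: etrans _ (esym (dE w v)).
apply: eq_complexP.
  exact: (derive_comm openD v w rF Dx).
exact: (derive_comm openD v w IF Dx).
Qed.

Lemma deriv_quat v (a b c d : V -> R) x :
  smooth D a -> smooth D b -> smooth D c -> smooth D d -> D x ->
  deriv_mx v (fun y => quat (a y) (b y) (c y) (d y)) x =
  quat ('D_v a x) ('D_v b x) ('D_v c x) ('D_v d x).
Proof.
move=> sa sb sc sd Dx.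
have h (k l : V -> R) i j :
    (fun y => quat (a y) (b y) (c y) (d y) i j) = (fun y => k y +i* l y)%C ->
    deriv_mx v (fun y => quat (a y) (b y) (c y) (d y)) x i j =
    ('D_v k x +i* 'D_v l x)%C by rewrite deriv_mxE => ->.
apply: eq_mx22; rewrite [RHS]mx2E.
- by apply: h; apply/funext => y; rewrite mx2E.
- by apply: h; apply/funext => y; rewrite mx2E.
- rewrite -(smooth_deriveN _ sc Dx).
  by apply: (h (fun y => - c y)); apply/funext => y; rewrite mx2E.
- rewrite -(smooth_deriveN _ sb Dx).
  by apply: (h _ (fun y => - b y)); apply/funext => y; rewrite mx2E.
Qed.

Lemma smooth_quat (f0 f1 f2 f3 : V -> R) :
  smooth D f0 -> smooth D f1 -> smooth D f2 -> smooth D f3 ->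
  smooth_mx D (fun p => quat (f0 p) (f1 p) (f2 p) (f3 p)).
Proof.
move=> s0 s1 s2 s3.
have N (f : V -> R) : smooth D f -> smooth D (fun p => - f p).
  exact: smoothN.
have h (k l : V -> R) i j :
    (fun y => quat (f0 y) (f1 y) (f2 y) (f3 y) i j) = (fun y => k y +i* l y)%C ->
    smooth D k -> smooth D l ->
    smoothc (fun y => quat (f0 y) (f1 y) (f2 y) (f3 y) i j).
  by move=> -> sk sl.
move=> i j; have [->|->] := ord2P i; have [->|->] := ord2P j.
- by apply: (h f0 f1) => //; apply/funext => y; rewrite mx2E.
- by apply: (h f2 f3) => //; apply/funext => y; rewrite mx2E.
- by apply: (h (fun y => - f2 y) f3); [|exact: N|] => //;
    apply/funext => y; rewrite mx2E.
- by apply: (h f0 (fun y => - f1 y)); [| |exact: N] => //;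
    apply/funext => y; rewrite mx2E.
Qed.

End MatrixCalculus.

Section Sandwich.
Context {R : realType}.
Implicit Types P Q W X Y : 'M[R[i]]_2.

Lemma sandwich_pullback P Q W : SU2 P -> SU2 Q ->
  invmx (P *m adjoint Q) *m (P *m W *m adjoint Q) = Q *m W *m adjoint Q.
Proof.
move=> SP SQ; rewrite (SU2_inv (SU2_mul SP (SU2_adjoint SQ))) adjointM adjointK.
by rewrite -!mulmxA (mulmxA _ P) (proj2 SP) mul1mx.
Qed.

Lemma sandwich_rsc P Q X Y a b :
  rsc a (P *m X *m Q) + rsc b (P *m Y *m Q) =
  P *m (rsc a X + rsc b Y) *m Q.
Proof. by rewrite /rsc mulmxDr mulmxDl -!scalemxAr -!scalemxAl. Qed.

Lemma sandwich_eq0 P Q W : SU2 P -> SU2 Q ->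
  P *m W *m adjoint Q = 0 -> W = 0.
Proof.
move=> SP SQ /(congr1 (fun Z => adjoint P *m Z *m Q)).
by rewrite mulmx0 mul0mx -!mulmxA (proj2 SQ) mulmx1 mulmxA (proj2 SP) mul1mx.
Qed.

End Sandwich.

(** * Surfaces from admissible frames *)

Section FrameGeometry.
Context {R : realType}.
Local Notation Re := complex.Re.
Local Notation Im := complex.Im.
Variables (M : set (R * R)) (openM : open M).
Variables (Fh : R * R -> R[i] -> 'M[R[i]]_2) (au av B1 Bm1 : R * R -> 'M[R[i]]_2).
Hypothesis frameF : admissible_frame M Fh au av B1 Bm1.

Definition loop_at (c : R) (p : R * R) := Fh p (c%:C)%C.

Lemma real_complex_neq0 (c : R) : c != 0 -> (c%:C)%C != 0 :> R[i].
Proof. by move=> c0; rewrite (fmorph_eq0 (real_complex R)). Qed.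

(** Real parameters are their own conjugates, so invariance under [tau] becomes
    unitarity. *)
Lemma loop_at_SU2 c p : c != 0 -> M p -> SU2 (loop_at c p).
Proof.
move=> /real_complex_neq0 c0 Mp; have [detF _ _ tauF] := frame_loop frameF Mp.
split; first exact: detF.
have := tauF _ c0; rewrite /tau conjc_real -/(loop_at c p) => {2}<-.
have uF : adjoint (loop_at c p) \in unitmx.
  by rewrite unitmxE /adjoint det_map_mx det_tr (detF _ c0) rmorph1 unitr1.
by rewrite mulmxV.
Qed.

Lemma smooth_loop_at c : c != 0 -> smooth_mx M (loop_at c).
Proof.
move=> c0 i j; have [rF IF] := frame_smooth frameF i j.
have ME p : M p -> [set q : (R * R) * (R * R) | M q.1 /\ q.2 != 0] (p, (c, 0)).
  by move=> Mp; split=> //=; rewrite xpair_eqE negb_and c0.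
by split; [exact: smooth_slice ME rF|exact: smooth_slice ME IF].
Qed.

Lemma deriv_loop c p : c != 0 -> M p ->
  pu (loop_at c) p = loop_at c p *m (au p + rsc c (B1 p)) /\
  pv (loop_at c) p = loop_at c p *m (av p + rsc c^-1 (Bm1 p)).
Proof.
move=> c0 Mp; have cC0 := real_complex_neq0 c0.
have [Eu Ev] := frame_mc frameF Mp cC0.
have uF : loop_at c p \in unitmx.
  by rewrite unitmxE (proj1 (loop_at_SU2 c0 Mp)) unitr1.
split.
  by rewrite -[rsc c _]/(_ *: _) -Eu /maurer_cartan mulmxA mulmxV// mul1mx.
have -> : rsc c^-1 (Bm1 p) = (c%:C)%C^-1 *: Bm1 p by rewrite /rsc fmorphV.
by rewrite -Ev /maurer_cartan mulmxA mulmxV// mul1mx.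
Qed.

(** At parameter 1 the Maurer-Cartan form is [alpha_0 + B1 du + B_-1 dv], whose
    smoothness follows from that of the frame; subtract [alpha_0]. *)
Lemma smooth_B : smooth_mx M B1 /\ smooth_mx M Bm1.
Proof.
have [sau sav] := frame_alpha_smooth frameF.
have sF := smooth_loop_at (@oner_neq0 R).
have sN F : smooth_mx M F -> smooth_mx M (fun p => (- 1)%:M *m F p).
  by move=> sF'; apply: smooth_mxM => //; exact: smooth_mx_cst.
have sU := smooth_mxD openM (smooth_mxM openM (smooth_mx_adjoint openM sF)
             (smooth_mx_deriv openM (dir 0) sF)) (sN _ sau).
have sV := smooth_mxD openM (smooth_mxM openM (smooth_mx_adjoint openM sF)
             (smooth_mx_deriv openM (dir 1) sF)) (sN _ sav).
split; [apply: smooth_mx_eq sU|apply: smooth_mx_eq sV] => // p Mp.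
  have [Eu _] := deriv_loop (@oner_neq0 R) Mp.
  rewrite -/(pu (loop_at 1)) Eu mulmxA (proj2 (loop_at_SU2 (@oner_neq0 R) Mp)).
  by rewrite mul1mx mul_scalar_mx scaleN1r addrC addrA addNr add0r /rsc scale1r.
have [_ Ev] := deriv_loop (@oner_neq0 R) Mp.
rewrite -/(pv (loop_at 1)) Ev mulmxA (proj2 (loop_at_SU2 (@oner_neq0 R) Mp)).
by rewrite mul1mx mul_scalar_mx scaleN1r addrC addrA addNr add0r /rsc invr1 scale1r.
Qed.

(** [alpha_0 = (s du + t dv) e3], [B1 = a1 e1 + a2 e2], [B_-1 = b1 e1 + b2 e2]. *)
Let s p := Im (au p 0 0).
Let t p := Im (av p 0 0).
Let a1 p := Re (B1 p 0 1).
Let a2 p := Im (B1 p 0 1).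
Let b1 p := Re (Bm1 p 0 1).
Let b2 p := Im (Bm1 p 0 1).

Lemma au_quat p : M p -> au p = quat 0 (s p) 0 0.
Proof. by move=> Mp; apply/in_k_quat; have [] := frame_alpha_k frameF Mp. Qed.

Lemma av_quat p : M p -> av p = quat 0 (t p) 0 0.
Proof. by move=> Mp; apply/in_k_quat; have [] := frame_alpha_k frameF Mp. Qed.

Lemma B1_quat p : M p -> B1 p = quat 0 0 (a1 p) (a2 p).
Proof. by move=> Mp; apply/in_p_quat; have [] := frame_B_p frameF Mp. Qed.

Lemma Bm1_quat p : M p -> Bm1 p = quat 0 0 (b1 p) (b2 p).
Proof. by move=> Mp; apply/in_p_quat; have [] := frame_B_p frameF Mp. Qed.

Let ss : smooth M s. Proof. by have [/(_ 0 0)[]] := frame_alpha_smooth frameF. Qed.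
Let st : smooth M t. Proof. by have [_ /(_ 0 0)[]] := frame_alpha_smooth frameF. Qed.
Let sa1 : smooth M a1. Proof. by have [/(_ 0 1)[]] := smooth_B. Qed.
Let sa2 : smooth M a2. Proof. by have [/(_ 0 1)[]] := smooth_B. Qed.
Let sb1 : smooth M b1. Proof. by have [_ /(_ 0 1)[]] := smooth_B. Qed.
Let sb2 : smooth M b2. Proof. by have [_ /(_ 0 1)[]] := smooth_B. Qed.

Lemma u_form_quat c p : M p ->
  au p + rsc c (B1 p) = quat 0 (s p) (c * a1 p) (c * a2 p).
Proof.
by move=> Mp; rewrite au_quat// B1_quat// rsc_quat quatD; congr quat; ring.
Qed.

Lemma v_form_quat c p : M p ->
  av p + rsc c (Bm1 p) = quat 0 (t p) (c * b1 p) (c * b2 p).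
Proof.
by move=> Mp; rewrite av_quat// Bm1_quat// rsc_quat quatD; congr quat; ring.
Qed.

(** Equality of the mixed derivatives of the frame at parameter [c] amounts to
    [U_v - V_u = U V - V U] for its Maurer-Cartan form [U du + V dv]; the three
    equations are the [e3], [e1] and [e2] parts. *)
Lemma zero_curvature c p : c != 0 -> M p ->
  [/\ 'D_(dir 1) s p - 'D_(dir 0) t p = 2 * (a1 p * b2 p - a2 p * b1 p),
      c * ('D_(dir 1) a1 p - 2 * t p * a2 p) =
      c^-1 * ('D_(dir 0) b1 p - 2 * s p * b2 p) &
      c * ('D_(dir 1) a2 p + 2 * t p * a1 p) =
      c^-1 * ('D_(dir 0) b2 p + 2 * s p * b1 p)].
Proof.
move=> c0 Mp; have sF := smooth_loop_at c0.
pose U q := quat 0 (s q) (c * a1 q) (c * a2 q).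
pose V q := quat 0 (t q) (c^-1 * b1 q) (c^-1 * b2 q).
have Z k (f : R * R -> R) : smooth M f -> smooth M (fun q => k * f q).
  by move=> sf; apply: (smoothM openM) => //; exact: smooth_cst.
have c0s : smooth M (fun=> 0 : R) by exact: smooth_cst.
have sU : smooth_mx M U by apply: smooth_quat => //; exact: Z.
have sV : smooth_mx M V by apply: smooth_quat => //; exact: Z.
have Fu q : M q -> pu (loop_at c) q = loop_at c q *m U q.
  by move=> Mq; have [-> _] := deriv_loop c0 Mq; rewrite u_form_quat.
have Fv q : M q -> pv (loop_at c) q = loop_at c q *m V q.
  by move=> Mq; have [_ ->] := deriv_loop c0 Mq; rewrite v_form_quat.
have dU := deriv_quat (dir 1) c0s ss (Z c _ sa1) (Z c _ sa2) Mp.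
have dV := deriv_quat (dir 0) c0s st (Z c^-1 _ sb1) (Z c^-1 _ sb2) Mp.
have := deriv_mx_comm openM (dir 1) (dir 0) sF Mp.
rewrite (deriv_mx_eq openM _ Fu Mp) (deriv_mx_eq openM _ Fv Mp).
rewrite (deriv_mxM openM _ sF sU Mp) (deriv_mxM openM _ sF sV Mp).
rewrite dU dV [deriv_mx (dir 0) _ p](Fu p Mp) [deriv_mx (dir 1) _ p](Fv p Mp).
have uF : loop_at c p \in unitmx.
  by rewrite unitmxE (proj1 (loop_at_SU2 c0 Mp)) unitr1.
rewrite -!mulmxA -!mulmxDr => /(can_inj (mulKmx uF)).
rewrite !quatM !quatD => /quat_inj[_ E3 E1 E2]; move: E1 E2 E3.
rewrite (smooth_deriveZ _ _ sa1 Mp) (smooth_deriveZ _ _ sa2 Mp).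
rewrite (smooth_deriveZ _ _ sb1 Mp) (smooth_deriveZ _ _ sb2 Mp).
move: ('D_(dir 1) a1 p) ('D_(dir 1) a2 p) ('D_(dir 1) s p) => a1v a2v sv.
move: ('D_(dir 0) b1 p) ('D_(dir 0) b2 p) ('D_(dir 0) t p) => b1u b2u tu.
move: (s p) (t p) (a1 p) (a2 p) (b1 p) (b2 p) => S T x1 x2 y1 y2 E1 E2 E3.
split.
- have e (x y : R) : c * x * (c^-1 * y) = x * y by rewrite mulrACA divff// mul1r.
  have e' (x y : R) : c^-1 * x * (c * y) = x * y.
    by rewrite mulrACA mulVf// mul1r.
  by move: E3; rewrite !e !e'; lra.
- by rewrite !mulrBr; move: E1; lra.
- by rewrite !mulrDr; move: E2; lra.
Qed.

(** The last two equations of [zero_curvature] read [c x = c^-1 y] with [x], [y]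
    independent of [c]; two values of [c] with distinct squares force [x = y = 0]. *)
Lemma structure_equations p : M p ->
  [/\ 'D_(dir 1) a1 p = 2 * t p * a2 p, 'D_(dir 1) a2 p = - (2 * t p * a1 p),
      'D_(dir 0) b1 p = 2 * s p * b2 p, 'D_(dir 0) b2 p = - (2 * s p * b1 p) &
      'D_(dir 1) s p - 'D_(dir 0) t p = 2 * (a1 p * b2 p - a2 p * b1 p)].
Proof.
move=> Mp; have [E3 E1 E2] := zero_curvature (@oner_neq0 R) Mp.
have two0 : (2 : R) != 0 by rewrite pnatr_eq0.
have [_ E1' E2'] := zero_curvature two0 Mp.
have sep (x y : R) : 1 * x = 1^-1 * y -> 2 * x = 2^-1 * y -> x = 0 /\ y = 0.
  rewrite invr1 !mul1r => -> /eqP; rewrite -subr_eq0 -mulrBl mulf_eq0 => /orP[].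
    by rewrite subr_eq0 => /eqP h; lra.
  by move=> /eqP.
have [/eqP + /eqP +] := sep _ _ E1 E1'; rewrite !subr_eq0 => /eqP-> /eqP->.
have [/eqP + /eqP +] := sep _ _ E2 E2'; rewrite !addr_eq0 => /eqP-> /eqP->.
by split.
Qed.

Variables (mu : R) (mu_neq1 : mu != 1) (mu_neq0 : mu != 0).
Let F p := loop_at 1 p.
Let G p := loop_at mu p.
Let f p := G p *m invmx (F p).
(** [f^-1 df = Ad_F (X du + Y dv)], see [pu_surface] and [pv_surface]. *)
Let X p := rsc (mu - 1) (B1 p).
Let Y p := rsc (mu^-1 - 1) (Bm1 p).

Let F_SU2 p : M p -> SU2 (F p). Proof. exact: loop_at_SU2 (oner_neq0 R). Qed.
Let G_SU2 p : M p -> SU2 (G p). Proof. exact: loop_at_SU2. Qed.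

Lemma surface_SU2 p : M p -> SU2 (f p).
Proof.
move=> Mp; rewrite /f (SU2_inv (F_SU2 Mp)).
by apply: SU2_mul (G_SU2 Mp) (SU2_adjoint (F_SU2 Mp)).
Qed.

Lemma surface_adjoint p : M p -> f p = G p *m adjoint (F p).
Proof. by move=> Mp; rewrite /f (SU2_inv (F_SU2 Mp)). Qed.

Let sF : smooth_mx M F. Proof. exact: smooth_loop_at (oner_neq0 R). Qed.
Let sG : smooth_mx M G. Proof. exact: smooth_loop_at. Qed.

Lemma smooth_surface : smooth_mx M f.
Proof.
apply: (smooth_mx_eq openM (fun p Mp => esym (surface_adjoint Mp))).
exact: smooth_mxM sG (smooth_mx_adjoint openM sF).
Qed.

(** The last factor is the inverse of [F]; as [Q] is skew-Hermitian, it
    contributes [adjoint Q *m adjoint F = - Q *m adjoint F]. *)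
Lemma deriv_sandwich (v : R * R) (W : R * R -> 'M[R[i]]_2) (P Q : 'M[R[i]]_2) p :
  smooth_mx M W -> M p -> deriv_mx v G p = G p *m P ->
  deriv_mx v F p = F p *m Q -> adjoint Q = - Q ->
  deriv_mx v (fun q => G q *m W q *m adjoint (F q)) p =
  G p *m (P *m W p + deriv_mx v W p - W p *m Q) *m adjoint (F p).
Proof.
move=> sW Mp dG dF aQ.
rewrite (deriv_mxM openM _ (smooth_mxM openM sG sW) (smooth_mx_adjoint openM sF) Mp).
rewrite (deriv_mxM openM _ sG sW Mp) (deriv_mx_adjoint _ sF Mp) dG dF.
rewrite adjointM aQ; move: (deriv_mx v W p) => dW.
by rewrite mulNmx mulmxN mulmxBr mulmxDr mulmxBl !mulmxA.
Qed.

Let u_form k p := quat 0 (s p) (k * a1 p) (k * a2 p).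
Let v_form k p := quat 0 (t p) (k * b1 p) (k * b2 p).

Lemma deriv_sandwich_u W p : smooth_mx M W -> M p ->
  pu (fun q => G q *m W q *m adjoint (F q)) p =
  G p *m (u_form mu p *m W p + pu W p - W p *m u_form 1 p) *m adjoint (F p).
Proof.
move=> sW Mp; apply: deriv_sandwich => //.
- by have [E _] := deriv_loop mu_neq0 Mp; rewrite [LHS]E u_form_quat.
- by have [E _] := deriv_loop (oner_neq0 R) Mp; rewrite [LHS]E u_form_quat.
- exact: (su2_quat _ _ _).2.
Qed.

Lemma deriv_sandwich_v W p : smooth_mx M W -> M p ->
  pv (fun q => G q *m W q *m adjoint (F q)) p =
  G p *m (v_form mu^-1 p *m W p + pv W p - W p *m v_form 1 p) *m adjoint (F p).
Proof.
move=> sW Mp; apply: deriv_sandwich => //.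
- by have [_ E] := deriv_loop mu_neq0 Mp; rewrite [LHS]E v_form_quat.
- by have [_ E] := deriv_loop (oner_neq0 R) Mp; rewrite [LHS]E v_form_quat// invr1.
- exact: (su2_quat _ _ _).2.
Qed.

Lemma X_quat p : M p -> X p = quat 0 0 ((mu - 1) * a1 p) ((mu - 1) * a2 p).
Proof. by move=> Mp; rewrite /X B1_quat// rsc_quat mulr0. Qed.

Lemma Y_quat p : M p -> Y p = quat 0 0 ((mu^-1 - 1) * b1 p) ((mu^-1 - 1) * b2 p).
Proof. by move=> Mp; rewrite /Y Bm1_quat// rsc_quat mulr0. Qed.

Let fE p : M p -> f p = G p *m 1%:M *m adjoint (F p).
Proof. by move=> Mp; rewrite mulmx1 surface_adjoint. Qed.

Lemma pu_surface p : M p -> pu f p = G p *m X p *m adjoint (F p).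
Proof.
move=> Mp; apply: etrans (deriv_mx_eq openM (dir 0) fE Mp) _.
apply: etrans (deriv_sandwich_u (smooth_mx_cst _ _) Mp) _.
congr (_ *m _ *m _); rewrite [pu _ p]deriv_mx_cst addr0 mulmx1 mul1mx X_quat//.
by rewrite quatN quatD; congr quat; ring.
Qed.

Lemma pv_surface p : M p -> pv f p = G p *m Y p *m adjoint (F p).
Proof.
move=> Mp; apply: etrans (deriv_mx_eq openM (dir 1) fE Mp) _.
apply: etrans (deriv_sandwich_v (smooth_mx_cst _ _) Mp) _.
congr (_ *m _ *m _); rewrite [pv _ p]deriv_mx_cst addr0 mulmx1 mul1mx Y_quat//.
by rewrite quatN quatD; congr quat; ring.
Qed.

Lemma surface_pullback p W : M p ->
  invmx (f p) *m (G p *m W *m adjoint (F p)) = F p *m W *m adjoint (F p).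
Proof.
move=> Mp; rewrite (surface_adjoint Mp).
exact: sandwich_pullback (G_SU2 Mp) (F_SU2 Mp).
Qed.

Lemma sphere_metric_sandwich p W W' : M p ->
  sphere_metric (f p) (G p *m W *m adjoint (F p)) (G p *m W' *m adjoint (F p)) =
  su2_ip W W'.
Proof.
move=> Mp; rewrite /sphere_metric !(surface_pullback _ Mp).
exact: su2_ip_conj (F_SU2 Mp).
Qed.

Let normal p := f p *m (F p *m e3 *m invmx (F p)).

Lemma normal_sandwich p : M p -> normal p = G p *m e3 *m adjoint (F p).
Proof.
move=> Mp; rewrite /normal (SU2_inv (F_SU2 Mp)) surface_adjoint// -!mulmxA.
by rewrite (mulmxA _ (F p)) (proj2 (F_SU2 Mp)) mul1mx.
Qed.

Lemma unit_normal_surface : unit_normal M f normal.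
Proof.
move=> p Mp; rewrite (pu_surface Mp) (pv_surface Mp) (normal_sandwich Mp).
rewrite !(sphere_metric_sandwich _ _ Mp) (surface_pullback _ Mp).
rewrite (X_quat Mp) (Y_quat Mp) e3_quat !su2_ip_quat; split; [|ring|ring|ring].
have [tr0 ad] := su2_quat (1 : R) 0 0; split.
  by rewrite mxtrace_mulC mulmxA (proj2 (F_SU2 Mp)) mul1mx.
by rewrite !adjointM adjointK ad mulNmx mulmxN mulmxA.
Qed.

Let sX : smooth_mx M X.
Proof.
apply: (smooth_mx_eq openM (F := fun p => ((mu - 1)%:C)%C%:M *m B1 p)).
  by move=> p _; rewrite mul_scalar_mx.
apply: smooth_mxM => //; [exact: smooth_mx_cst|exact: smooth_B.1].
Qed.

Let sY : smooth_mx M Y.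
Proof.
apply: (smooth_mx_eq openM (F := fun p => ((mu^-1 - 1)%:C)%C%:M *m Bm1 p)).
  by move=> p _; rewrite mul_scalar_mx.
apply: smooth_mxM => //; [exact: smooth_mx_cst|exact: smooth_B.2].
Qed.

Let Z k (h : R * R -> R) : smooth M h -> smooth M (fun q => k * h q).
Proof. by move=> sh; apply: (smoothM openM) => //; exact: smooth_cst. Qed.

Lemma deriv_X v p : M p -> deriv_mx v X p =
  quat 0 0 ('D_v (fun q => (mu - 1) * a1 q) p) ('D_v (fun q => (mu - 1) * a2 q) p).
Proof.
move=> Mp; rewrite (deriv_mx_eq openM v X_quat Mp).
have c0s : smooth M (fun=> 0 : R) by exact: smooth_cst.
by rewrite (deriv_quat v c0s c0s (Z _ sa1) (Z _ sa2) Mp) derive_cst.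
Qed.

Lemma deriv_Y v p : M p -> deriv_mx v Y p =
  quat 0 0 ('D_v (fun q => (mu^-1 - 1) * b1 q) p)
           ('D_v (fun q => (mu^-1 - 1) * b2 q) p).
Proof.
move=> Mp; rewrite (deriv_mx_eq openM v Y_quat Mp).
have c0s : smooth M (fun=> 0 : R) by exact: smooth_cst.
by rewrite (deriv_quat v c0s c0s (Z _ sb1) (Z _ sb2) Mp) derive_cst.
Qed.

Let R4_ip_normal p a b c d : M p ->
  R4_ip (invmx (f p) *m (G p *m quat a b c d *m adjoint (F p)))
        (invmx (f p) *m normal p) = b.
Proof.
move=> Mp; rewrite (normal_sandwich Mp) !(surface_pullback _ Mp) e3_quat.
rewrite (R4_ip_conj _ _ _ _ _ _ _ _ (F_SU2 Mp)) R4_ip_quat; ring.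
Qed.

(** The [p]-part of the Maurer-Cartan form along [u] is parallel to [X], and
    the product of parallel elements of [p] is real; the other terms lie in [p]. *)
Lemma puu_surface_normal p : M p ->
  R4_ip (invmx (f p) *m pu (pu f) p) (invmx (f p) *m normal p) = 0.
Proof.
move=> Mp.
have -> : pu (pu f) p = G p *m (u_form mu p *m X p + pu X p -
                                X p *m u_form 1 p) *m adjoint (F p).
  apply: etrans (deriv_mx_eq openM (dir 0) pu_surface Mp) _.
  exact: deriv_sandwich_u sX Mp.
rewrite [pu X p](deriv_X _ Mp) (X_quat Mp) !quatM !quatN !quatD.
by rewrite (R4_ip_normal _ _ _ _ Mp); ring.
Qed.

(** The [e3] part comes from [mu^-1 B_-1 X - X B_-1] alone. *)
Lemma puv_surface_normal p : M p ->
  R4_ip (invmx (f p) *m pv (pu f) p) (invmx (f p) *m normal p) =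
  - ((mu - 1) * (mu^-1 + 1)) * (a1 p * b2 p - a2 p * b1 p).
Proof.
move=> Mp.
have -> : pv (pu f) p = G p *m (v_form mu^-1 p *m X p + pv X p -
                                X p *m v_form 1 p) *m adjoint (F p).
  apply: etrans (deriv_mx_eq openM (dir 1) pu_surface Mp) _.
  exact: deriv_sandwich_v sX Mp.
rewrite [pv X p](deriv_X _ Mp) (X_quat Mp) !quatM !quatN !quatD.
by rewrite (R4_ip_normal _ _ _ _ Mp); ring.
Qed.

Lemma pvv_surface_normal p : M p ->
  R4_ip (invmx (f p) *m pv (pv f) p) (invmx (f p) *m normal p) = 0.
Proof.
move=> Mp.
have -> : pv (pv f) p = G p *m (v_form mu^-1 p *m Y p + pv Y p -
                                Y p *m v_form 1 p) *m adjoint (F p).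
  apply: etrans (deriv_mx_eq openM (dir 1) pv_surface Mp) _.
  exact: deriv_sandwich_v sY Mp.
rewrite [pv Y p](deriv_Y _ Mp) (Y_quat Mp) !quatM !quatN !quatD.
by rewrite (R4_ip_normal _ _ _ _ Mp); ring.
Qed.

Lemma second_form_surface p (xi : R * R) : M p ->
  second_form f normal p xi =
  - (2 * ((mu - 1) * (mu^-1 + 1)) * (a1 p * b2 p - a2 p * b1 p)) * (xi.1 * xi.2).
Proof.
move=> Mp; transitivity (0 * xi.1 ^+ 2 +
  2 * (- ((mu - 1) * (mu^-1 + 1)) * (a1 p * b2 p - a2 p * b1 p)) *
  (xi.1 * xi.2) + 0 * xi.2 ^+ 2); last by ring.
congr (_ * _ + 2 * _ * _ + _ * _).
- exact: puu_surface_normal.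
- exact: puv_surface_normal.
- exact: pvv_surface_normal.
Qed.

Lemma sphere_metric_surface p : M p ->
  [/\ sphere_metric (f p) (pu f p) (pu f p) =
        (mu - 1) * a1 p * ((mu - 1) * a1 p) + (mu - 1) * a2 p * ((mu - 1) * a2 p),
      sphere_metric (f p) (pu f p) (pv f p) =
        (mu - 1) * a1 p * ((mu^-1 - 1) * b1 p) +
        (mu - 1) * a2 p * ((mu^-1 - 1) * b2 p),
      sphere_metric (f p) (pv f p) (pu f p) =
        (mu - 1) * a1 p * ((mu^-1 - 1) * b1 p) +
        (mu - 1) * a2 p * ((mu^-1 - 1) * b2 p) &
      sphere_metric (f p) (pv f p) (pv f p) =
        (mu^-1 - 1) * b1 p * ((mu^-1 - 1) * b1 p) +
        (mu^-1 - 1) * b2 p * ((mu^-1 - 1) * b2 p)].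
Proof.
move=> Mp; rewrite (pu_surface Mp) (pv_surface Mp).
rewrite !(sphere_metric_sandwich _ _ Mp) (X_quat Mp) (Y_quat Mp) !su2_ip_quat.
by split; ring.
Qed.

Lemma first_form_surface p (xi : R * R) : M p ->
  first_form f p xi =
  (mu - 1) ^+ 2 * (a1 p ^+ 2 + a2 p ^+ 2) * xi.1 ^+ 2 +
  2 * ((mu - 1) * (mu^-1 - 1) * (a1 p * b1 p + a2 p * b2 p)) * (xi.1 * xi.2) +
  (mu^-1 - 1) ^+ 2 * (b1 p ^+ 2 + b2 p ^+ 2) * xi.2 ^+ 2.
Proof.
move=> Mp; have [E00 E01 _ E11] := sphere_metric_surface Mp.
congr (_ * _ + 2 * _ * _ + _ * _).
- by apply: etrans E00 _; ring.
- by apply: etrans E01 _; ring.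
- by apply: etrans E11 _; ring.
Qed.

Hypothesis regularF : regular_frame M B1 Bm1.

Let mu1 : mu - 1 != 0. Proof. by rewrite subr_eq0. Qed.
Let muV1 : mu^-1 - 1 != 0. Proof. by rewrite subr_eq0 invr_eq1. Qed.

(** If the cross product vanished, then [b1 B1 = a1 B_-1] and [b2 B1 = a2 B_-1],
    and independence would make all four coordinates zero. *)
Lemma regular_cross p : M p -> a1 p * b2 p - a2 p * b1 p != 0.
Proof.
move=> Mp; apply/eqP => c0; have := regularF Mp.
rewrite B1_quat// Bm1_quat// => indep.
have q k l : rsc k (quat 0 0 (a1 p) (a2 p)) + rsc l (quat 0 0 (b1 p) (b2 p)) =
    quat 0 0 (k * a1 p + l * b1 p) (k * a2 p + l * b2 p).
  by rewrite !rsc_quat quatD; congr quat; ring.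
have [|b10 /eqP] := indep (b1 p) (- a1 p).
  by rewrite q quat0; congr quat; lra.
rewrite oppr_eq0 => /eqP a10.
have [|b20 /eqP] := indep (b2 p) (- a2 p).
  by rewrite q quat0; congr quat; lra.
rewrite oppr_eq0 => /eqP a20.
have [|] := indep 1 0; first by rewrite q quat0 b10 b20 a10 a20; congr quat; ring.
by move/eqP; rewrite oner_eq0.
Qed.

Lemma immersion_surface : immersion M f.
Proof.
split; [exact: surface_SU2|exact: smooth_surface|].
move=> p Mp a b; rewrite (pu_surface Mp) (pv_surface Mp) sandwich_rsc.
move=> /(sandwich_eq0 (G_SU2 Mp) (F_SU2 Mp)).
rewrite /X /Y /rsc !scalerA -!rmorphM.
move=> /(regularF Mp)[/eqP + /eqP +]; rewrite !mulf_eq0.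
by rewrite (negbTE mu1) (negbTE muV1) !orbF => /eqP-> /eqP->.
Qed.

(** Here [x] and [y] are the coordinates of [X] and [Y], and
    [s_v - t_u = 2 (B1 x B_-1)] gives [K / 2 * (mu - 1) * (mu^-1 - 1) = 2]. *)
Lemma gauss_curvature_surface p : M p ->
  gauss_curvature (induced_metric f) p = 1 - ((mu + 1) / (mu - 1)) ^+ 2.
Proof.
have se := structure_equations.
apply: (@gauss_curvature_moving_frame R M openM
  (fun q => (mu - 1) * a1 q) (fun q => (mu - 1) * a2 q)
  (fun q => (mu^-1 - 1) * b1 q) (fun q => (mu^-1 - 1) * b2 q) s t) => //;
  try exact: Z; move=> q Mq.
- rewrite (smooth_deriveZ _ _ sa1 Mq); have [-> _ _ _ _] := se q Mq; ring.
- rewrite (smooth_deriveZ _ _ sa2 Mq); have [_ -> _ _ _] := se q Mq; ring.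
- rewrite (smooth_deriveZ _ _ sb1 Mq); have [_ _ -> _ _] := se q Mq; ring.
- rewrite (smooth_deriveZ _ _ sb2 Mq); have [_ _ _ -> _] := se q Mq; ring.
- have [_ _ _ _ ->] := se q Mq; field.
  by rewrite mu_neq0.
- have -> : (mu - 1) * a1 q * ((mu^-1 - 1) * b2 q) -
    (mu - 1) * a2 q * ((mu^-1 - 1) * b1 q) =
    (mu - 1) * (mu^-1 - 1) * (a1 q * b2 q - a2 q * b1 q) by ring.
  by rewrite !mulf_neq0// regular_cross.
- by have [E _ _ _] := sphere_metric_surface Mq; rewrite mxE.
- by have [_ E _ _] := sphere_metric_surface Mq; rewrite mxE.
- by have [_ _ E _] := sphere_metric_surface Mq; rewrite mxE.
- by have [_ _ _ E] := sphere_metric_surface Mq; rewrite mxE.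
Qed.

Lemma oriented_angle_coord p phi : M p -> oriented_angle (B1 p) (Bm1 p) phi ->
  [/\ su2_norm (B1 p) ^+ 2 = a1 p ^+ 2 + a2 p ^+ 2,
      su2_norm (Bm1 p) ^+ 2 = b1 p ^+ 2 + b2 p ^+ 2,
      su2_norm (B1 p) * su2_norm (Bm1 p) * cos phi = a1 p * b1 p + a2 p * b2 p &
      su2_norm (B1 p) * su2_norm (Bm1 p) * sin phi = a1 p * b2 p - a2 p * b1 p].
Proof.
move=> Mp [th []].
have nB1 : su2_norm (B1 p) ^+ 2 = a1 p ^+ 2 + a2 p ^+ 2.
  rewrite /su2_norm B1_quat// su2_ip_quat mul0r add0r -!expr2 sqr_sqrtr//.
  by rewrite addr_ge0 ?sqr_ge0.
have nBm1 : su2_norm (Bm1 p) ^+ 2 = b1 p ^+ 2 + b2 p ^+ 2.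
  rewrite /su2_norm Bm1_quat// su2_ip_quat mul0r add0r -!expr2 sqr_sqrtr//.
  by rewrite addr_ge0 ?sqr_ge0.
move: nB1 nBm1; move: (su2_norm _) (su2_norm _) => r r' nB1 nBm1.
rewrite B1_quat// Bm1_quat// !p_quat !rsc_quat.
move=> /quat_inj[_ _ Ea1 Ea2] /quat_inj[_ _ Eb1 Eb2].
rewrite cosD sinD in Eb1 Eb2.
have cs := cos2Dsin2 th.
split=> //; rewrite Ea1 Ea2 Eb1 Eb2; rewrite -[LHS]mulr1 -cs; ring.
Qed.

End FrameGeometry.

Theorem lemma3p1 (R : realType) (M : set (R * R))
  (openM : open M) (scM : simply_connected M)
  (Fh : R * R -> R[i] -> 'M[R[i]]_2)
  (au av B1 Bm1 : R * R -> 'M[R[i]]_2)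
  (frameF : admissible_frame M Fh au av B1 Bm1)
  (regularF : regular_frame M B1 Bm1)
  (mu : R) (mu_neq1 : mu != 1) (mu_neq0 : mu != 0)
  (phi : R * R -> R)
  (phiP : forall p, M p -> oriented_angle (B1 p) (Bm1 p) (phi p)) :
  let F := fun p => Fh p 1 in
  let f := fun p => Fh p (mu%:C)%C *m invmx (F p) in
  let n := fun p => f p *m (F p *m e3 *m invmx (F p)) in
  let rho := (mu + 1) / (mu - 1) in
  let A := fun p => (mu - 1) * su2_norm (B1 p) in
  let B := fun p => (mu^-1 - 1) * su2_norm (Bm1 p) in
  [/\ immersion M f,
      forall p, M p -> gauss_curvature (induced_metric f) p = 1 - rho ^+ 2,
      forall p, M p -> forall xi : R * R,
        first_form f p xi =
          A p ^+ 2 * xi.1 ^+ 2 + 2 * A p * B p * cos (phi p) * (xi.1 * xi.2)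
          + B p ^+ 2 * xi.2 ^+ 2,
      unit_normal M f n &
      forall p, M p -> forall xi : R * R,
        second_form f n p xi =
          2 * rho * A p * B p * sin (phi p) * (xi.1 * xi.2)].
Proof.
move=> F f n rho A B; split.
- exact: (immersion_surface openM frameF mu_neq1 mu_neq0 regularF).
- exact: (gauss_curvature_surface openM frameF mu_neq1 mu_neq0 regularF).
- move=> p Mp xi.
  have [n1 n2 c _] := oriented_angle_coord frameF Mp (phiP p Mp).
  rewrite [LHS](first_form_surface openM frameF mu_neq0 xi Mp) /A /B.
  by rewrite -n1 -n2 -c; ring.
- exact: (unit_normal_surface openM frameF mu_neq0).
- move=> p Mp xi.
  have [_ _ _ c] := oriented_angle_coord frameF Mp (phiP p Mp).
  rewrite [LHS](second_form_surface openM frameF mu_neq0 xi Mp) -c /rho /A /B.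
  by field; rewrite mu_neq0 subr_eq0 mu_neq1.
Qed.
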